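(* For every integer $r\geq3$ and $\beta\in(0,1)$ there is a constant $\theta=\theta(r,\beta)>0$ such that the following holds. Let $G=(V,E)$ be an $r$-graph such that the (real) rank of $\{\mathbf{1}_{\delta(U)}:U\subseteq V,\ |U|\text{ odd},\ |\delta(U)|=r\}$ is at most $(1-\beta)|E|$. Then the number of perfect matchings of $G$ that intersect every minimum odd cut exactly once is at least $e^{\theta|E|}$.
   Context: For $U\subseteq V$, $\delta(U)$ is the set of edges with exactly one end in $U$; it is an odd cut if $|U|$ is odd. For an integer $r\geq3$, an $r$-graph is an $r$-regular graph $G=(V,E)$ with $|V|$ even in which every odd cut has size at least $r$. A minimum odd cut is an odd cut of minimum size. $\mathbf{1}_{X}\in\mathbb{R}^E$ is the indicator vector of $X\subseteq E$. *)

(* Defs.v *)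
From HB Require Import structures.
From mathcomp Require Import all_boot all_order all_algebra.

Set Implicit Arguments.
Unset Strict Implicit.
Unset Printing Implicit Defensive.

(* Finite graphs with parallel edges allowed, as usual for r-graphs. Loops are
   left out: at a loop of an r-regular graph, the odd cut around its vertex
   would have fewer than r edges. *)
Record multigraph := Multigraph {
  vertex : finType;
  edge : finType;
  ends : edge -> {set vertex};
  card_ends : forall e, #|ends e| = 2 }.

Section Graphs.

Variable G : multigraph.
Implicit Types (U : {set vertex G}) (C M : {set edge G}) (v : vertex G).

Definition star v : {set edge G} := [set e | v \in ends e].

Definition regular (r : nat) : Prop := forall v, #|star v| = r.

Definition cut U : {set edge G} := [set e | #|ends e :&: U| == 1].

Definition odd_cut C : bool :=
  [exists U : {set vertex G}, odd #|U| && (C == cut U)].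

Definition min_odd_cut C : bool :=
  odd_cut C && [forall C' : {set edge G}, odd_cut C' ==> (#|C| <= #|C'|)].

Definition r_graph (r : nat) : Prop :=
  [/\ regular r, ~~ odd #|vertex G| & forall C, odd_cut C -> r <= #|C|].

Definition perfect_matching M : bool := [forall v, #|M :&: star v| == 1].

Definition tight_perfect_matchings : {set {set edge G}} :=
  [set M | perfect_matching M &
           [forall C : {set edge G}, min_odd_cut C ==> (#|M :&: C| == 1)]].

Definition r_cut_sides (r : nat) : {set {set vertex G}} :=
  [set U : {set vertex G} | odd #|U| & #|cut U| == r].

Section Rank.

Variable R : fieldType.

Definition indicator C : {ffun edge G -> R^o} := [ffun e => (e \in C)%:R%R].

Definition odd_cut_rank (r : nat) : nat :=
  \dim (span [seq indicator (cut U) | U in r_cut_sides r]).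

End Rank.

End Graphs.

(* Main.v *)
Require Import Defs.
From HB Require Import structures.
From mathcomp Require Import all_boot all_order all_algebra.
From mathcomp Require Import all_classical all_reals all_analysis.
From mathcomp Require Import ring lra zify.
Import boot.fintype boot.finset Defs.
Import Order.TTheory GRing.Theory Num.Theory.

Set Implicit Arguments.
Unset Strict Implicit.
Unset Printing Implicit Defensive.

Local Open Scope ring_scope.

(** The point [1/r + eps * y] lies in the perfect matching polytope whenever [y]
    is orthogonal to all odd cuts of size [r], [|y| <= 1] coordinatewise and
    [eps = 1/(r(r+1))]: an odd cut of size [k > r] has slack for a perturbation
    of size [k * eps].  By Edmonds' theorem it is then a convex combination of
    perfect matchings, and these all meet every minimum odd cut exactly once.

    Now draw integer edge weights uniformly from [{0, .., q}] and centre them.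
    If a large set of weight vectors had small inner product with all such
    [y], then by the Sauer-Shelah lemma it would shatter a coordinate set [J] of
    size at least [rank + k]; a vertex [y] of the section of the cube by the
    space of such vectors supported on [J] has [k] coordinates equal to [1] or
    [-1], and two shattering weight vectors following the signs of [y] and of
    [-y] differ by at least [k] in the direction [y], a contradiction.  So for
    most weights some tight perfect matching has weight exceeding the average
    by a linear amount.  A Chernoff bound shows that a fixed matching does so
    only for an exponentially small proportion of the weights, so there must be
    exponentially many tight perfect matchings. *)


(** * Linear-algebraic preliminaries *)

(** The minimum of [a c / - b c] over the constraints with [b c < 0] is the first time at which one
    of them becomes tight. *)
Lemma exists_tight_shift (R : realFieldType) (C : finType) (P : pred C)
    (a b : C -> R) :
  (forall c, P c -> 0 < a c) -> (exists2 c, P c & b c < 0) ->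
  exists2 t : R, 0 < t & (forall c, P c -> 0 <= a c + t * b c) /\
                         (exists2 c, P c & a c + t * b c = 0).
Proof.
move=> a_gt0 [c0 Pc0 bc0].
have Qc0 : P c0 && (b c0 < 0) by rewrite Pc0.
case: (@arg_minP _ _ _ c0 (fun c => P c && (b c < 0))
         (fun c => a c / - b c) Qc0) => c /andP[Pc bc] cmin.
have a0 := a_gt0 _ Pc.
exists (a c / - b c); first by rewrite divr_gt0 ?oppr_gt0.
split; last first.
  by exists c => //; field; rewrite lt_eqF.
move=> d Pd; have ad := a_gt0 _ Pd.
have t0 : 0 < a c / - b c by rewrite divr_gt0 ?oppr_gt0.
have [bd|bd] := ltP (b d) 0; last first.
  by apply: addr_ge0 (ltW ad) _; apply: mulr_ge0 (ltW t0) bd.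
have := cmin d; rewrite Pd bd => /(_ isT).
by rewrite ler_pdivlMr ?oppr_gt0 // mulrN lerNl -subr_ge0 opprK addrC.
Qed.

Lemma exists_kernel (R : fieldType) (E F : finType) (K : {set E}) (B : {set F})
    (f : F -> E -> R) :
  (#|B| < #|K|)%N ->
  exists y : E -> R, [/\ exists e, y e != 0, forall e, e \notin K -> y e = 0 &
    forall b, b \in B -> \sum_(e in K) y e * f b e = 0].
Proof.
move=> ltBK.
have /card_gt0P[k0 Kk0] : (0 < #|K|)%N by apply: leq_ltn_trans ltBK.
pose A : 'M[R]_(#|K|, #|B|) := \matrix_(i, j) f (enum_val j) (enum_val i).
have : kermx A != 0.
  rewrite -mxrank_eq0 mxrank_ker subn_eq0 -ltnNge.
  exact: leq_ltn_trans (rank_leq_col A) ltBK.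
case/rowV0Pn => u /sub_kermxP uA0 u_neq0.
pose y e := if e \in K then u 0 (enum_rank_in Kk0 e) else 0.
have yE i : y (enum_val i) = u 0 i.
  by rewrite /y enum_valP enum_valK_in.
exists y; split.
- case/rV0Pn: u_neq0 => i ui; exists (enum_val i); by rewrite yE.
- by move=> e /negbTE eK; rewrite /y eK.
- move=> b Bb; rewrite big_enum_val /=.
  have := congr1 (fun M : 'rV_ _ => M 0 (enum_rank_in Bb b)) uA0.
  rewrite !mxE => uA; rewrite -[RHS]uA.
  by apply: eq_bigr => i _; rewrite !mxE yE enum_rankK_in.
Qed.

(** * Edmonds' perfect matching polytope *)

Section Edmonds.

Variables (R : realFieldType) (V E : finType).
Implicit Types (s t : E -> V) (A X Y : {set V}) (x y : E -> R) (e f : E).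

Definition delta s t X : {set E} := [set e | (s e \in X) (+) (t e \in X)].

(* Loops and isolated vertices are allowed, with [A] the vertices that have to
   be matched, so that contracting a vertex set changes neither type. *)
Record fractional_matching A s t x : Prop := FractionalMatching {
  fm_ends : forall e, (s e \in A) && (t e \in A);
  fm_ge0 : forall e, 0 <= x e;
  fm_loop : forall e, s e = t e -> x e = 0;
  fm_star : forall v, v \in A -> \sum_(e in delta s t [set v]) x e = 1;
  fm_cut : forall X, X \subset A -> odd #|X| ->
    1 <= \sum_(e in delta s t X) x e }.

(** Membership in the convex hull of perfect matchings. An index of weight zero may carry any edge
    set, as happens in the products of families formed below. *)
Definition decomposable A s t x : Prop :=
  exists (I : finType) (l : I -> R) (M : I -> {set E}),
    [/\ forall i, 0 <= l i, \sum_i l i = 1,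
        forall i, 0 < l i ->
          forall v, v \in A -> #|M i :&: delta s t [set v]| = 1
      & forall e, \sum_i l i * (e \in M i)%:R = x e].

Lemma delta_setD A s t X : (forall e, (s e \in A) && (t e \in A)) ->
  delta s t (A :\: X) = delta s t X.
Proof.
move=> endsA; apply/setP=> e; rewrite !inE.
by case/andP: (endsA e) => -> ->; rewrite !andbT addbN addNb negbK.
Qed.

Lemma fm_even A s t x : fractional_matching A s t x -> ~~ odd #|A|.
Proof.
move=> fm; apply/negP => /(fm_cut fm (subxx A)).
rewrite big_pred0 ?ler10 // => e; rewrite inE.
by case/andP: (fm_ends fm e) => -> ->.
Qed.

Lemma weight_eq0 (I : finType) (l : I -> R) (M : I -> {set E}) e :
  (forall i, 0 <= l i) -> \sum_i l i * (e \in M i)%:R = 0 ->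
  forall i, 0 < l i -> e \notin M i.
Proof.
move=> l_ge0 sum0 i li.
have/psumr_eq0P : forall i, true -> 0 <= l i * (e \in M i)%:R.
  by move=> j _; rewrite mulr_ge0 ?ler0n.
move=> /(_ sum0 i isT)/eqP; rewrite mulf_eq0 gt_eqF //=.
by rewrite pnatr_eq0 eqb0.
Qed.

Lemma sum_in_set (F : {set E}) (D : {set E}) :
  \sum_(e in D) (e \in F)%:R = #|F :&: D|%:R :> R.
Proof.
rewrite -sum1_card natr_sum big_mkcond [RHS]big_mkcond /=.
by apply: eq_bigr => e _; rewrite inE; do 2 case: (_ \in _).
Qed.

(** Both families put mass [x e] on each edge [e] of [D], so choosing the two members independently
    given a common edge preserves the marginal. Where [x e = 0] the quotient is zero by convention,
    and no [M i] of positive weight contains [e]. *)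
Lemma glue_marginal (D : {set E}) (I J : finType) (l : I -> R) (m : J -> R)
    (M : I -> {set E}) (N : J -> {set E}) x :
  (forall i, 0 <= l i) -> (forall i, 0 < l i -> #|M i :&: D| = 1) ->
  (forall e, e \in D -> \sum_i l i * (e \in M i)%:R = x e) ->
  (forall e, e \in D -> \sum_j m j * (e \in N j)%:R = x e) ->
  forall i, \sum_j \sum_(e in D)
     (l i * (e \in M i)%:R) * (m j * (e \in N j)%:R) / x e = l i.
Proof.
move=> l_ge0 MD lx mx i.
have := l_ge0 i; rewrite le0r => /orP[/eqP li0|li].
  by rewrite li0 big1 // => j _; rewrite big1 // => e _; rewrite !mul0r.
rewrite exchange_big /=.
transitivity (\sum_(e in D) l i * (e \in M i)%:R).
  apply: eq_bigr => e De.
  rewrite -mulr_suml -mulr_sumr mx // -mulrA.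
  have [xe0|xe0] := eqVneq (x e) 0; last by rewrite divff ?mulr1.
  have := weight_eq0 l_ge0 (eq_trans (lx _ De) xe0) li.
  by move/negbTE => ->; rewrite mulr0 mul0r.
by rewrite -mulr_sumr sum_in_set MD ?mulr1.
Qed.

(** A decomposition into perfect matchings of the graph with [X] shrunk to one vertex, the edge sets
    being read in the original graph. *)
Definition half_decomposable A s t X x : Prop :=
  exists (I : finType) (l : I -> R) (M : I -> {set E}),
    [/\ forall i, 0 <= l i, \sum_i l i = 1,
        forall i, 0 < l i -> [/\ #|M i :&: delta s t X| = 1,
          forall v, v \in A :\: X -> #|M i :&: delta s t [set v]| = 1
        & forall e, e \in M i -> ~~ ((s e \in X) && (t e \in X))]
      & forall e, ~~ ((s e \in X) && (t e \in X)) ->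
          \sum_i l i * (e \in M i)%:R = x e].

(** The two families are coupled along the single edge by which they cross the cut. Then
    [M i :|: N j] agrees with [N j] on edges meeting [X] and with [M i] on edges not inside [X], so
    it is a perfect matching with the right averages. *)
Lemma glue_decomposable A s t X x : (forall e, (s e \in A) && (t e \in A)) ->
  X \subset A ->
  half_decomposable A s t X x -> half_decomposable A s t (A :\: X) x ->
  decomposable A s t x.
Proof.
move=> endsA XA [I [l [M [l_ge0 l1 MP lM]]]] [J [m [N [m_ge0 m1 NP mN]]]].
have inC e v : v = s e \/ v = t e -> (v \in A :\: X) = (v \notin X).
  by case/andP: (endsA e) => sA tA [] ->; rewrite inE ?sA ?tA andbT.
have inCs e := inC e (s e) (or_introl erefl).
have inCt e := inC e (t e) (or_intror erefl).
set D := delta s t X.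
have lD e : e \in D -> \sum_i l i * (e \in M i)%:R = x e.
  by rewrite inE => De; apply: lM; case: (_ \in _) (_ \in _) De => [] [].
have mD e : e \in D -> \sum_j m j * (e \in N j)%:R = x e.
  rewrite inE => De; apply: mN; rewrite inCs inCt.
  by case: (_ \in _) (_ \in _) De => [] [].
have MD i : 0 < l i -> #|M i :&: D| = 1 by case/MP.
have ND j : 0 < m j -> #|N j :&: D| = 1.
  by case/NP; rewrite delta_setD.
pose c i j := \sum_(e in D)
   (l i * (e \in M i)%:R) * (m j * (e \in N j)%:R) / x e.
have cl i : \sum_j c i j = l i by exact: glue_marginal.
have cm j : \sum_i c i j = m j.
  rewrite -(glue_marginal m_ge0 ND mD lD j).
  apply: eq_bigr => i _; apply: eq_bigr => e _.
  by rewrite [X in X / _]mulrC.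
have x_ge0 e : e \in D -> 0 <= x e.
  by move=> /lD <-; apply: sumr_ge0 => i _; rewrite mulr_ge0 ?ler0n.
have c_ge0 i j : 0 <= c i j.
  by apply: sumr_ge0 => e De; rewrite divr_ge0 ?x_ge0 // !mulr_ge0 ?ler0n.
have c_gt0 i j : c i j != 0 ->
    [/\ 0 < l i, 0 < m j & exists2 e, M i :&: D = [set e] & N j :&: D = [set e]].
  move=> cij.
  have li : 0 < l i.
    rewrite lt0r l_ge0 andbT; apply: contraNneq cij => l0.
    by rewrite /c big1 // => e _; rewrite l0 !mul0r.
  have mj : 0 < m j.
    rewrite lt0r m_ge0 andbT; apply: contraNneq cij => l0.
    by rewrite /c big1 // => e _; rewrite l0 mul0r mulr0 mul0r.
  split=> //.
  have [e De MNe] : exists2 e, e \in D & (e \in M i) && (e \in N j).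
    apply/exists_inP; apply: contraNT cij => /exists_inPn H.
    rewrite /c big1 // => e /H; rewrite negb_and => /orP[]/negbTE->.
      by rewrite mulr0 !mul0r.
    by rewrite !mulr0 !mul0r.
  case/andP: MNe => Me Ne; exists e.
    have/eqP/cards1P[f Hf] := MD _ li.
    have : e \in M i :&: D by rewrite inE Me.
    by rewrite Hf inE => /eqP ->.
  have/eqP/cards1P[f Hf] := ND _ mj.
  have : e \in N j :&: D by rewrite inE Ne.
  by rewrite Hf inE => /eqP ->.
have MN_out i j e : c i j != 0 -> ~~ ((s e \in X) && (t e \in X)) ->
    (e \in M i :|: N j) = (e \in M i).
  case/c_gt0 => li mj [f Mf Nf] He; rewrite inE orbC.
  case: (boolP (e \in N j)) => //= Ne.
  have [_ _ /(_ _ Ne)] := NP _ mj; rewrite inCs inCt => He'.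
  have De : e \in D by rewrite inE; case: (_ \in _) (_ \in _) He He' => [] [].
  have : e \in N j :&: D by rewrite inE Ne.
  by rewrite Nf -Mf inE => /andP[->].
have MN_in i j e : c i j != 0 -> (s e \in X) || (t e \in X) ->
    (e \in M i :|: N j) = (e \in N j).
  case/c_gt0 => li mj [f Mf Nf] He; rewrite inE.
  case: (boolP (e \in M i)) => //= Me.
  have [_ _ /(_ _ Me) He'] := MP _ li.
  have De : e \in D by rewrite inE; case: (_ \in _) (_ \in _) He He' => [] [].
  have : e \in M i :&: D by rewrite inE Me.
  by rewrite Mf -Nf inE => /andP[->].
exists (I * J)%type, (fun ij => c ij.1 ij.2), (fun ij => M ij.1 :|: N ij.2).
split.
- by case=> i j; apply: c_ge0.
- by rewrite -(pair_bigA _ c) /= -l1; apply: eq_bigr => i _.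
- case=> i j /= cij v vA; have {}cij : c i j != 0 by rewrite gt_eqF.
  have [li mj _] := c_gt0 _ _ cij.
  have [vX|vX] := boolP (v \in X).
    rewrite -(_ : N j :&: delta s t [set v] = (M i :|: N j) :&: _).
      have [_ H _] := NP _ mj; apply: H.
      by rewrite setDDr setDv set0U inE vX vA.
    apply/setP=> e; rewrite 2!in_setI; case De: (e \in delta _ _ _); rewrite ?andbF // !andbT.
    rewrite MN_in //; move: De; rewrite !inE.
    by do 2 case: eqP => [->|_]; rewrite ?vX ?orbT.
  rewrite -(_ : M i :&: delta s t [set v] = (M i :|: N j) :&: _).
    have [_ H _] := MP _ li; apply: H.
    by rewrite inE vX vA.
  apply/setP=> e; rewrite 2!in_setI; case De: (e \in delta _ _ _); rewrite ?andbF // !andbT.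
  rewrite MN_out //; move: De; rewrite !inE.
  by do 2 case: eqP => [->|_]; rewrite ?(negbTE vX) ?andbF.
- move=> e; rewrite -(pair_bigA _ (fun i j => c i j * (e \in M i :|: N j)%:R)) /=.
  have [He|He] := boolP ((s e \in X) && (t e \in X)).
    rewrite exchange_big /= -mN; last first.
      by rewrite inCs inCt; case/andP: He => -> ->.
    apply: eq_bigr => j _; rewrite -cm mulr_suml; apply: eq_bigr => i _.
    have [->|cij] := eqVneq (c i j) 0; first by rewrite !mul0r.
    by rewrite MN_in //; case/andP: He => ->.
  rewrite -lM //.
  apply: eq_bigr => i _; rewrite -cl mulr_suml; apply: eq_bigr => j _.
  have [->|cij] := eqVneq (c i j) 0; first by rewrite !mul0r.
  by rewrite MN_out.
Qed.

(** * Contraction of a tight odd set *)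

Definition contract X (x0 v : V) : V := if v \in X then x0 else v.

Section Contraction.

Variables (A X : {set V}) (s t : E -> V) (x : E -> R) (x0 : V).
Hypotheses (fmx : fractional_matching A s t x) (XA : X \subset A).
Hypotheses (oddX : odd #|X|) (x0X : x0 \in X).
Hypothesis tightX : \sum_(e in delta s t X) x e = 1.

Let k := contract X x0.
Let A' := x0 |: (A :\: X).
Let x' e := if (s e \in X) && (t e \in X) then 0 else x e.

Let lift Y := if x0 \in Y then Y :|: X else Y.

Let contractE Y v : Y \subset A' -> (k v \in Y) = (v \in lift Y).
Proof.
move=> YA; rewrite /k /contract /lift.
case: ifP => vX; last by case: ifP; rewrite // inE vX orbF.
case: ifP => x0Y; first by rewrite inE vX orbT.
apply/esym/negbTE/negP => vY; move/subsetP/(_ _ vY): YA.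
by rewrite !inE vX /= orbF => /eqP vx0; rewrite -vx0 vY in x0Y.
Qed.

Let delta_contract Y : Y \subset A' ->
  delta (k \o s) (k \o t) Y = delta s t (lift Y).
Proof. by move=> YA; apply/setP=> e; rewrite !inE /= !contractE. Qed.

Let sum_contract Y : Y \subset A' ->
  \sum_(e in delta (k \o s) (k \o t) Y) x' e = \sum_(e in delta s t (lift Y)) x e.
Proof.
move=> YA; rewrite -delta_contract //; apply: eq_bigr => e.
rewrite inE /= /x'; case: ifP => // /andP[sX tX].
by rewrite /k /contract sX tX addbb.
Qed.

Let lift1 : lift [set x0] = X.
Proof. by rewrite /lift set11; apply/setUidPr; rewrite sub1set. Qed.

Let lift_out v : v \in A :\: X -> lift [set v] = [set v].
Proof.
rewrite !inE /lift inE => /andP[vX _].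
by case: eqP => // x0v; rewrite -x0v x0X in vX.
Qed.

(** Replacing [x0] by the odd set [X] keeps parity, so odd cuts of the contracted graph are odd cuts
    of the original one; the star of [x0] is the tight cut of [X]. *)
Lemma contract_fractional_matching :
  fractional_matching (x0 |: (A :\: X)) (contract X x0 \o s) (contract X x0 \o t)
    (fun e => if (s e \in X) && (t e \in X) then 0 else x e).
Proof.
have sA' v : v \in A -> k v \in A'.
  by move=> vA; rewrite !inE /k /contract; case: ifP => vX; rewrite ?eqxx // vX vA orbT.
split.
- by move=> e; case/andP: (fm_ends fmx e) => ? ?; rewrite !sA'.
- by move=> e; case: ifP => // _; apply: (fm_ge0 fmx).
- move=> e /=; case: ifP => //; rewrite /contract.
  case: ifP => sX; case: ifP => tX // _.
  + by move=> xt; rewrite -xt x0X in tX.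
  + by move=> xs; rewrite xs x0X in sX.
  + exact: (fm_loop fmx).
- move=> v vA'; have sv : [set v] \subset A' by rewrite sub1set.
  rewrite (sum_contract sv); move: vA'; rewrite in_setU1 => /orP[/eqP->|vA].
    by rewrite lift1.
  by rewrite lift_out //; apply: (fm_star fmx); move: vA; rewrite inE => /andP[].
- move=> Y YA oddY; rewrite (sum_contract YA); apply: (fm_cut fmx).
    rewrite /lift; case: ifP => _; last first.
      apply: subset_trans YA _; rewrite subUset sub1set (subsetP XA) //=.
      exact: subsetDl.
    rewrite subUset XA andbT; apply: subset_trans YA _.
    by rewrite subUset sub1set (subsetP XA) //= subsetDl.
  rewrite /lift; case: ifP => // x0Y.
  have -> : Y :|: X = X :|: (Y :\ x0).
    by apply/setP=> v; rewrite !inE orbC; case: eqP => //= ->; rewrite x0X.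
  have dj : [disjoint X & Y :\ x0].
    apply/pred0P => v /=; apply/negbTE/negP => /andP[vX]; rewrite inE => /andP[vx0 vY].
    move/subsetP/(_ _ vY): YA; rewrite !inE vX /= orbF => /eqP vx.
    by rewrite vx inE eqxx in vx0.
  rewrite cardsU disjoint_setI0 // cards0 subn0 oddD oddX.
  by move: oddY; rewrite (cardsD1 x0 Y) x0Y.
Qed.

(** The star of [x0] pulls back to the cut of [X], and edges inside [X], having weight zero, occur
    in no matching of positive weight. *)
Lemma half_of_contract :
  decomposable (x0 |: (A :\: X)) (contract X x0 \o s) (contract X x0 \o t)
    (fun e => if (s e \in X) && (t e \in X) then 0 else x e) ->
  half_decomposable A s t X x.
Proof.
case=> I [l [M [l_ge0 l1 MP lM]]]; exists I, l, M; split=> //.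
  move=> i li; split.
  - by rewrite -{1}lift1 -delta_contract ?sub1set ?setU11 // MP ?setU11.
  - move=> v vA; rewrite -(lift_out vA) -delta_contract ?sub1set ?inE /= ?MP //.
      by rewrite setU1r.
    by move: vA; rewrite !inE => ->; rewrite orbT.
  - move=> e; apply: contraL => He.
    by apply: weight_eq0 li => //; rewrite lM He.
by move=> e /negbTE He; rewrite lM He.
Qed.

End Contraction.

Lemma decomposable_convex A s t x1 x2 x (a b : R) :
  0 <= a -> 0 <= b -> a + b = 1 -> (forall e, x e = a * x1 e + b * x2 e) ->
  decomposable A s t x1 -> decomposable A s t x2 -> decomposable A s t x.
Proof.
move=> a0 b0 ab1 xE [I [l [M [l_ge0 l1 MP lM]]]] [J [m [N [m_ge0 m1 NP mN]]]].
exists (I + J)%type,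
  (fun k => match k with inl i => a * l i | inr j => b * m j end),
  (fun k => match k with inl i => M i | inr j => N j end).
split.
- by case=> i; rewrite mulr_ge0.
- by rewrite big_sumType /= -!mulr_sumr l1 m1 !mulr1.
- case=> i h; [apply: MP | apply: NP].
    by rewrite lt0r l_ge0 andbT; apply: contraTneq h => ->; rewrite mulr0 ltxx.
  by rewrite lt0r m_ge0 andbT; apply: contraTneq h => ->; rewrite mulr0 ltxx.
- move=> e; rewrite big_sumType /= xE -lM -mN !mulr_sumr.
  by congr (_ + _); apply: eq_bigr => i _; rewrite mulrA.
Qed.

(** * Perturbation of fractional matchings *)

Definition nontrivial_odd A X :=
  [&& X \subset A, odd #|X|, (1 < #|X|)%N & (1 < #|A :\: X|)%N].

Definition tight_cut s t x X := \sum_(e in delta s t X) x e == 1.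

(** The directions that keep the star equations and do not enlarge the support. *)
Definition star_kernel A s t x y : Prop :=
  (forall e, x e = 0 -> y e = 0) /\
  (forall v, v \in A -> \sum_(e in delta s t [set v]) y e = 0).

(** The motion along [y] stops at the first inequality that becomes tight. This is an edge weight or
    a nontrivial odd cut, since the trivial odd cuts are stars, whose equations [y] preserves. *)
Lemma fm_push A s t x y :
  fractional_matching A s t x ->
  (forall X, nontrivial_odd A X -> ~~ tight_cut s t x X) ->
  star_kernel A s t x y -> (exists e, y e != 0) ->
  exists2 d : R, 0 < d & fractional_matching A s t (fun e => x e + d * y e) /\
   ([set e | x e + d * y e != 0] \proper [set e | x e != 0] \/
    exists2 X, nontrivial_odd A X & tight_cut s t (fun e => x e + d * y e) X).
Proof.
move=> fmx ntight [yx ystar] [e0 ye0].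
pose P (c : E + {set V}) :=
  match c with inl e => x e != 0 | inr X => nontrivial_odd A X end.
pose a (c : E + {set V}) :=
  match c with inl e => x e | inr X => \sum_(e in delta s t X) x e - 1 end.
pose b (c : E + {set V}) :=
  match c with inl e => y e | inr X => \sum_(e in delta s t X) y e end.
have a_gt0 c : P c -> 0 < a c.
  case: c => [e|X] /= h; first by rewrite lt0r h (fm_ge0 fmx).
  rewrite subr_gt0 lt_neqAle eq_sym ntight //=.
  by case/and4P: h => *; apply: (fm_cut fmx).
(* [y] sums to zero over the star of an end of [e0], so it is negative somewhere and the motion
   cannot go on forever. *)
have [e ye] : exists e, y e < 0.
  have [y0|y0] := ltP (y e0) 0; first by exists e0.
  have {}y0 : 0 < y e0 by rewrite lt0r ye0.
  have xe0 : x e0 != 0 by apply: contraNneq ye0 => /yx ->.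
  have /andP[sA _] := fm_ends fmx e0.
  have De0 : e0 \in delta s t [set s e0].
    rewrite !inE eqxx /=; apply: contraNneq xe0 => ts.
    by rewrite (fm_loop fmx).
  apply/existsP; apply: contraT => /existsPn ge0.
  have : 0 < \sum_(e in delta s t [set s e0]) y e.
    rewrite (bigD1 e0) //= ltr_pwDl // sumr_ge0 // => e _.
    by rewrite leNgt ge0.
  by rewrite ystar // ltxx.
have [|d d0 [ab_ge0 [c Pc abc0]]] := exists_tight_shift a_gt0 (b := b).
  exists (inl e) => //=.
  by apply: contraTneq ye => /yx ->; rewrite ltxx.
have sumE X : \sum_(e in delta s t X) (x e + d * y e) =
    \sum_(e in delta s t X) x e + d * \sum_(e in delta s t X) y e.
  by rewrite big_split /= mulr_sumr.
exists d => //; split; last first.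
  case: c Pc abc0 => [f|X] /= h eq0; [left | right].
    rewrite properE; apply/andP; split.
      apply/subsetP => g; rewrite !inE; apply: contraNneq => xg.
      by rewrite (yx _ xg) xg mulr0 addr0.
    by apply/subsetPn; exists f; rewrite inE ?h // eq0 eqxx.
  by exists X => //; rewrite /tight_cut sumE -subr_eq0 -[X in _ == X]eq0 addrAC.
have star v : v \in A -> \sum_(e in delta s t [set v]) (x e + d * y e) = 1.
  by move=> vA; rewrite sumE ystar // mulr0 addr0 (fm_star fmx).
split=> //.
- exact: fm_ends fmx.
- move=> f; have [xf|xf] := eqVneq (x f) 0.
    by rewrite (yx _ xf) xf mulr0 addr0.
  exact: (ab_ge0 (inl f)).
- by move=> f /(fm_loop fmx) xf; rewrite xf yx // mulr0 addr0.
- move=> X XA oddX.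
  have [/cards1P[v Xv]|X1] := boolP (#|X| == 1)%N.
    by rewrite Xv star // -sub1set -Xv.
  have [/cards1P[v Xv]|X2] := boolP (#|A :\: X| == 1)%N.
    rewrite -(delta_setD X (fm_ends fmx)) Xv star //.
    have : v \in A :\: X by rewrite Xv set11.
    by rewrite inE => /andP[].
  (* Since [#|A|] is even, both sides of the cut are odd; neither being a single vertex, both have
     more than one. *)
  have := ab_ge0 (inr X); rewrite /= sumE addrAC subr_ge0; apply.
  rewrite /nontrivial_odd XA oddX /=.
  have evenA := fm_even fmx.
  move: (cardsID X A) X1 X2 evenA oddX; rewrite (setIidPr XA) => <-.
  by rewrite oddD; case: #|X| => [|[|n]]; case: #|A :\: X| => [|[|m]] //=; case: odd.
Qed.

Lemma delta1P s t e v : e \in delta s t [set v] ->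
  exists u, [/\ u != v, u = s e \/ u = t e &
    forall a, (e \in delta s t [set a]) = (a == v) || (a == u)].
Proof.
rewrite !inE; case: (eqVneq (s e) v) => [sv|nsv] /=.
  move=> tv; exists (t e); split=> //; first by right.
  move=> a; rewrite !inE sv ![_ == a]eq_sym; have [->|av] //= := eqVneq a v.
  by rewrite eq_sym tv.
move/eqP => tv; exists (s e); split=> //; first by left.
move=> a; rewrite !inE tv ![_ == a]eq_sym; have [->|av] := eqVneq a v.
  by rewrite eq_sym (negbTE nsv).
by rewrite addbF.
Qed.

Lemma sum_delta_pred1 (D : {set E}) e : \sum_(g in D) (g == e)%:R = (e \in D)%:R :> R.
Proof.
rewrite big_mkcond (bigD1 e) //= eqxx big1 ?addr0; first by case: (_ \in _).
by move=> g /negbTE ->; case: ifP.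
Qed.

Section NoPush.

Variables (A : {set V}) (s t : E -> V) (x : E -> R).
Hypothesis fmx : fractional_matching A s t x.

(** [D v] is the star of [v] in the support, [K] consists of the edges of fractional weight, and [Q]
    turns out to be the set of their ends. *)
Let S := [set e | x e != 0].
Let D v := S :&: delta s t [set v].
Let K := [set e in S | x e != 1].
Let Q := [set v in A | (1 < #|D v|)%N].

Let sum_supp y X : (forall e, x e = 0 -> y e = 0) ->
  \sum_(e in delta s t X) y e = \sum_(e in S :&: delta s t X) y e.
Proof.
move=> yx; rewrite [LHS](big_setID S) /= setIC [X in _ + X]big1 ?addr0 //.
by move=> e; rewrite !inE negbK => /andP[/eqP/yx].
Qed.

Let x_gt0 e : e \in S -> 0 < x e.
Proof. by rewrite inE lt0r => ->; rewrite (fm_ge0 fmx). Qed.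

Let sumD v : v \in A -> \sum_(e in D v) x e = 1.
Proof. by move=> vA; rewrite -sum_supp // (fm_star fmx). Qed.

(** The weights on [D v] are positive and sum to 1, so [e] has weight 1 exactly when it is alone
    there. *)
Let degE e v : v \in A -> e \in D v -> (1 < #|D v|)%N = (x e != 1).
Proof.
move=> vA De; have := sumD vA; rewrite (big_setD1 e) //= (cardsD1 e) De ltnS.
have [/set0Pn[f Df] sum1|/negPn/eqP D0] := boolP (D v :\ e != set0); last first.
  by rewrite D0 cards0 big_set0 addr0 => ->; rewrite eqxx.
rewrite card_gt0; have -> : D v :\ e != set0 by apply/set0Pn; exists f.
have : 0 < \sum_(i in D v :\ e) x i.
  rewrite (bigD1 f) //= ltr_pwDl //.
    by apply: x_gt0; move: Df; rewrite in_setD1 => /andP[_]; rewrite inE => /andP[].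
  by apply: sumr_ge0 => i _; apply: (fm_ge0 fmx).
by move=> ?; apply/esym/eqP => xe1; move: sum1; rewrite xe1; lra.
Qed.

Let D_s e : e \in S -> e \in D (s e).
Proof.
move=> eS; rewrite inE eS !inE eqxx /=; apply: contraTneq eS => st.
by rewrite inE negbK (fm_loop fmx).
Qed.

Let D_t e : e \in S -> e \in D (t e).
Proof.
move=> eS; rewrite inE eS !inE eqxx addbT /=; apply: contraTneq eS => st.
by rewrite inE negbK (fm_loop fmx).
Qed.

Let sA e : s e \in A. Proof. by case/andP: (fm_ends fmx e). Qed.
Let tA e : t e \in A. Proof. by case/andP: (fm_ends fmx e). Qed.

Let decomposable_matching : Q = set0 -> decomposable A s t x.
Proof.
move=> Q0; have D1 v : v \in A -> #|D v| = 1%N.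
  move=> vA; apply/eqP; rewrite eqn_leq; apply/andP; split.
    rewrite leqNgt; apply/negP => D2.
    by have := in_set0 v; rewrite -Q0 inE vA D2.
  rewrite card_gt0; apply/eqP => D0; have := sumD vA.
  by rewrite D0 big_set0 => /esym/eqP; rewrite oner_eq0.
exists unit, (fun=> 1), (fun=> S); split=> //.
- by rewrite big_const card_unit /= addr0.
- move=> e; rewrite big_const card_unit /= addr0 mul1r.
  have [eS|] := boolP (e \in S); last by rewrite inE negbK => /eqP ->.
  have := degE (sA e) (D_s eS); rewrite D1 // => /esym/negbFE/eqP -> //.
Qed.

Let sub_DK v : v \in Q -> D v \subset K.
Proof.
rewrite inE => /andP[vA D2]; apply/subsetP => e De.
by rewrite inE -(degE vA De) D2 andbT; move: De; rewrite inE => /andP[].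
Qed.

(** Handshake count: both ends of an edge of [K] lie in [Q], and all support edges at a vertex of
    [Q] lie in [K]. *)
Let card_QK : (\sum_(v in Q) #|D v| = 2 * #|K|)%N.
Proof.
transitivity (\sum_(v in Q) \sum_(e in K) (e \in delta s t [set v]))%N.
  apply: eq_bigr => v Qv.
  rewrite -sum1_card big_mkcond [RHS]big_mkcond /=.
  apply: eq_bigr => e _; case: (boolP (e \in D v)) => [De|].
    by rewrite (subsetP (sub_DK Qv)) //; move: De; rewrite inE => /andP[_ ->].
  case: (boolP (e \in K)) => //; rewrite ![in X in X -> _]inE => /andP[xe _].
  by rewrite inE inE xe /= => /negbTE ->.
rewrite exchange_big /= mulnC -sum_nat_const; apply: eq_bigr => e Ke.
have [eS x1] : e \in S /\ x e != 1 by move: Ke; rewrite inE => /andP[].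
have Qs : s e \in Q by rewrite inE sA (degE (sA e) (D_s eS)).
have Qt : t e \in Q by rewrite inE tA (degE (tA e) (D_t eS)).
have st : s e != t e.
  by apply: contraTneq eS => st; rewrite inE negbK (fm_loop fmx).
rewrite (bigD1 (s e)) //= (bigD1 (t e)) /=; last by rewrite Qt eq_sym.
rewrite big1 => [|v /andP[/andP[_ /negbTE vs] /negbTE vt]]; last first.
  by rewrite !inE ![_ == v]eq_sym vs vt.
by rewrite !inE !eqxx (negbTE st) eq_sym (negbTE st).
Qed.

(* The rest of the support is a 2-regular graph of weight 1/2; three
   consecutive vertices of it span a tight cut. *)
Let regular_case v0 : v0 \in Q -> (forall v, v \in Q -> #|D v| = 2%N) ->
  (forall e, e \in K -> x e = 1 / 2) ->
  (exists2 X, nontrivial_odd A X & tight_cut s t x X) \/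
  (exists2 y, star_kernel A s t x y & exists e, y e != 0).
Proof.
move=> Qv0 D2 xK.
have QA v : v \in Q -> v \in A by rewrite inE => /andP[].
have DS v k : k \in D v -> k \in S by rewrite inE => /andP[].
have inD v k : k \in S -> (k \in delta s t [set v]) = (k \in D v).
  by move=> kS; rewrite [in RHS]inE kS.
have DQ v k : v \in Q -> k \in D v -> forall u, u = s k \/ u = t k -> u \in Q.
  move=> Qv Dk; have kS := DS _ _ Dk.
  move: Qv; rewrite inE => /andP[vA]; rewrite (degE vA Dk) => x1 u [] ->.
    by rewrite inE sA (degE (sA k) (D_s kS)).
  by rewrite inE tA (degE (tA k) (D_t kS)).
have neq0S k : k \in S -> forall g, x g = 0 -> (g == k) = false.
  by rewrite inE => xk g xg; apply: contraNF xk => /eqP <-; rewrite xg.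
have [e [f [ef Dv]]] := cards2P _ (introT eqP (D2 _ Qv0)).
have De : e \in D v0 by rewrite Dv !inE eqxx.
have Df : f \in D v0 by rewrite Dv !inE eqxx orbT.
have eS := DS _ _ De; have fS := DS _ _ Df.
have [u [uv uends He]] : exists u, [/\ u != v0, u = s e \/ u = t e &
    forall a, (e \in delta s t [set a]) = (a == v0) || (a == u)].
  by apply: delta1P; rewrite inD.
have [w [wv wends Hf]] : exists u, [/\ u != v0, u = s f \/ u = t f &
    forall a, (f \in delta s t [set a]) = (a == v0) || (a == u)].
  by apply: delta1P; rewrite inD.
have Qu := DQ _ _ Qv0 De _ uends; have Qw := DQ _ _ Qv0 Df _ wends.
(* If [u = w], then [e] and [f] are parallel and weight can be shifted from one to the other. *)
have [uw|uw] := eqVneq u w.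
  right; exists (fun g => (g == e)%:R - (g == f)%:R).
    split=> [g xg|a _]; first by rewrite !neq0S // subrr.
    by rewrite sumrB !sum_delta_pred1 He Hf uw subrr.
  by exists e; rewrite eqxx (negbTE ef) subr0 oner_neq0.
have Du_e : e \in D u by rewrite -inD // He eqxx orbT.
have Dw_f : f \in D w by rewrite -inD // Hf eqxx orbT.
have pick2 v k : v \in Q -> k \in D v -> exists2 g, g != k & D v = [set k; g].
  move=> Qv Dk; have [a [b [ab Dab]]] := cards2P _ (introT eqP (D2 _ Qv)).
  move: Dk; rewrite Dab !inE => /orP[]/eqP ->.
    by exists b; rewrite // eq_sym.
  by exists a; rewrite // setUC.
have [g ge Du] := pick2 _ _ Qu Du_e; have [h hf Dw] := pick2 _ _ Qw Dw_f.
have Du_g : g \in D u by rewrite Du !inE eqxx orbT.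
have Dw_h : h \in D w by rewrite Dw !inE eqxx orbT.
have gS := DS _ _ Du_g; have hS := DS _ _ Dw_h.
have Kg := subsetP (sub_DK Qu) _ Du_g; have Kh := subsetP (sub_DK Qw) _ Dw_h.
have gf : g != f.
  apply: contraTneq Du_g => ->; rewrite -inD // Hf.
  by rewrite (negbTE uv) (negbTE uw).
have he : h != e.
  apply: contraTneq Dw_h => ->; rewrite -inD // He.
  by rewrite (negbTE wv) eq_sym (negbTE uw).
pose X := [set u; v0; w].
have XS k : k \in S -> (k \in delta s t X) =
    (k \in [set e; g]) (+) (k \in [set e; f]) (+) (k \in [set f; h]).
  move=> kS; rewrite -Du -Dv -Dw -!inD // !inE.
  have in3 a : (a == u) || (a == v0) || (a == w) = (a == u) (+) (a == v0) (+) (a == w).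
    have [->|_] := eqVneq a u; first by rewrite (negbTE uv) (negbTE uw).
    have [->|_] := eqVneq a v0; first by rewrite eq_sym (negbTE wv).
    by case: eqVneq.
  by rewrite !in3; do 6 case: (_ == _).
have XA : X \subset A.
  by apply/subsetP => a; rewrite !inE => /orP[/orP[]|] /eqP ->; apply: QA.
have X3 : #|X| = 3%N.
  by rewrite /X setUC cardsU1 cards2 !inE uv eq_sym (negbTE uw) (negbTE wv).
have oddX : odd #|X| by rewrite X3.
(* If [g = h], the edges form a triangle on [X], and no support edge would leave this odd set. *)
have gh : g != h.
  apply/eqP => gh; have := fm_cut fmx XA oddX.
  rewrite sum_supp // big_pred0 ?ler10 // => k; rewrite in_setI.
  have [kS|//] := boolP (k \in S); rewrite XS // !inE gh /=.
  have [->|ke] := eqVneq k e; first by rewrite (negbTE ef) eq_sym (negbTE he).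
  have [->|kf] := eqVneq k f; first by rewrite eq_sym (negbTE hf).
  by case: (k == h).
have SX : S :&: delta s t X = [set g; h].
  apply/setP=> k; rewrite in_setI; have [kS|kS] /= := boolP (k \in S); last first.
    apply/esym/negbTE; apply: contra kS; rewrite !inE.
    by move=> /orP[]/eqP->; [move: gS | move: hS]; rewrite inE.
  rewrite XS // !inE; have [->|ke] := eqVneq k e.
    by rewrite (negbTE ef) ![e == _]eq_sym (negbTE he) (negbTE ge).
  have [->|kf] := eqVneq k f.
    by rewrite ![f == _]eq_sym (negbTE gf) (negbTE hf).
  have [->|kg] := eqVneq k g; first by rewrite (negbTE gh).
  by [].
have tightX : tight_cut s t x X.
  by rewrite /tight_cut sum_supp // SX big_setU1 ?inE //= big_set1 !xK //; apply/eqP; field.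
have [C1|C1] := ltnP 1 #|A :\: X|.
  by left; exists X => //; rewrite /nontrivial_odd XA X3 C1.
have/cards1P[z Cz] : #|A :\: X| == 1%N.
  have := fm_even fmx; rewrite -(cardsID X A) (setIidPr XA) X3.
  by case: #|_| C1 => [|[]].
(* Now [e], [f], [h], [g] form a 4-cycle through the remaining vertex [z]; the direction alternates
   along it. *)
right; exists (fun k => (k == e)%:R - (k == f)%:R + (k == h)%:R - (k == g)%:R).
  split=> [k xk|a aA]; first by rewrite !neq0S // subrr addr0 subrr.
  rewrite sumrB big_split sumrB /= !sum_delta_pred1.
  have /or4P[] : [|| a == u, a == v0, a == w | a == z].
    by rewrite -(in_set1 a z) -Cz in_setD aA andbT !inE !orbA orbN.
  - move/eqP->; rewrite !inD // Du !inE !eqxx ![_ == g]eq_sym (negbTE gf) ?(negbTE gh) orbT.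
    by rewrite [f == e]eq_sym (negbTE ef) (negbTE he); ring.
  - move/eqP->; rewrite !inD // Dv !inE !eqxx orbT (negbTE he) (negbTE hf) (negbTE ge) (negbTE gf).
    by ring.
  - move/eqP->; rewrite !inD // Dw !inE !eqxx (negbTE gf) (negbTE gh) orbT.
    by rewrite (negbTE ef) [e == h]eq_sym (negbTE he); ring.
  move/eqP->; have zX k : k \in S -> (k \in delta s t [set z]) = (k \in [set g; h]).
    by move=> kS; rewrite -SX in_setI kS -Cz delta_setD //; apply: fm_ends fmx.
  rewrite !zX // !inE !eqxx orbT ![_ == g]eq_sym (negbTE gf) (negbTE ge).
  by rewrite ![_ == h]eq_sym (negbTE hf) (negbTE he); ring.
exists e; rewrite eqxx (negbTE ef) ![e == _]eq_sym (negbTE he) (negbTE ge).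
by rewrite subr0 addr0 subr0 oner_neq0.
Qed.

(** With [Q] empty, [x] is itself a matching. If [K] has more edges than [Q] has vertices, the star
    equations have a nonzero solution on [K]. Otherwise the handshake count forces degree 2 on [Q];
    each star there has two edges of total weight 1, so [x - 1/2] on [K] is a solution, and it is
    nonzero unless [x] is constantly 1/2 on [K]. *)
Lemma fm_cases : decomposable A s t x \/
  (exists2 X, nontrivial_odd A X & tight_cut s t x X) \/
  (exists2 y, star_kernel A s t x y & exists e, y e != 0).
Proof.
have [Q0|/set0Pn[v0 Qv0]] := eqVneq Q set0; first by left; apply: decomposable_matching.
right.
have KS e : x e = 0 -> e \notin K by move=> xe; rewrite !inE xe eqxx.
have KD v : v \in A -> v \notin Q -> forall e, e \in D v -> e \notin K.
  move=> vA vQ e De; rewrite inE -(degE vA De) negb_and.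
  by move: vQ; rewrite inE vA /= => ->; rewrite orbT.
have [QK|KQ] := ltnP #|Q| #|K|.
  have [y [y0 yK ystar]] :=
    exists_kernel (fun v e => (e \in delta s t [set v])%:R : R) QK.
  right; exists y => //; have yx e : x e = 0 -> y e = 0 by move=> /KS/yK.
  split=> // v vA; have [Qv|Qv] := boolP (v \in Q); last first.
    by rewrite sum_supp // big1 // => e De; apply: yK; apply: KD De.
  rewrite -[RHS](ystar v Qv) big_mkcond [RHS]big_mkcond /=.
  apply: eq_bigr => e _; have [eK|/yK ->] := boolP (e \in K).
    by case: (_ \in _); rewrite ?mulr1 ?mulr0.
  by case: (_ \in _).
have D2 v : v \in Q -> #|D v| = 2%N.
  have leD : forall i, i \in Q -> (2 <= #|D i| ?= iff (2 == #|D i|))%N.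
    by move=> i; rewrite inE => /andP[_ Di]; split.
  have [_] := leqif_sum leD; rewrite card_QK sum_nat_const mulnC.
  have -> : (2 * #|Q| == 2 * #|K|)%N.
    rewrite eqn_leq; apply/andP; split; last by rewrite leq_mul2l KQ.
    have : (\sum_(i in Q) 2 <= \sum_(i in Q) #|D i|)%N by apply: leq_sum => i /leD[].
    by rewrite card_QK sum_nat_const mulnC.
  by move/esym/forall_inP => H /H/eqP.
have [xK|] := boolP [forall e in K, x e == 1 / 2].
  by apply: (regular_case Qv0 D2) => e Ke; apply/eqP; apply: (forall_inP xK).
case/forall_inPn => e Ke xe.
right; exists (fun e => if e \in K then x e - 1 / 2 else 0); last first.
  by exists e; rewrite Ke subr_eq0.
have yx f : x f = 0 -> (if f \in K then x f - 1 / 2 else 0) = 0.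
  by move=> /KS/negbTE ->.
split=> // v vA; rewrite (sum_supp _ yx); have [Qv|Qv] := boolP (v \in Q); last first.
  by apply: big1 => f /(KD _ vA Qv)/negbTE ->.
transitivity (\sum_(f in D v) (x f - 1 / 2)).
  by apply: eq_bigr => f Df; rewrite (subsetP (sub_DK Qv)).
by rewrite sumrB sumD // sumr_const D2 // -mulr_natr; lra.
Qed.

End NoPush.

(** Induction on the number of vertices, then on the support. At a nontrivial tight cut each side is
    contracted in turn and the two decompositions are glued. Otherwise [x] lies between the points
    reached by pushing along [y] and along [- y], each of which has smaller support or a tight
    cut. *)
Lemma pm_polytope A s t x : fractional_matching A s t x -> decomposable A s t x.
Proof.
have [n] := ubnP #|A|; elim: n A s t x => // n IHn A s t x /ltnSE leAn.
have tight_case y X : fractional_matching A s t y ->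
    nontrivial_odd A X -> tight_cut s t y X -> decomposable A s t y.
  move=> fmy /and4P[XA oddX X1 CX1] /eqP tightX.
  have half Y : Y \subset A -> odd #|Y| -> (1 < #|Y|)%N ->
      \sum_(e in delta s t Y) y e = 1 -> half_decomposable A s t Y y.
    move=> YA oddY Y1 tightY.
    have /card_gt0P[x0 x0Y] : (0 < #|Y|)%N by apply: ltnW.
    apply: (half_of_contract (x0 := x0)) => //.
    apply: IHn (contract_fractional_matching fmy YA oddY x0Y tightY).
    apply: leq_trans leAn; rewrite cardsU1 !inE x0Y /=.
    by rewrite -(cardsID Y A) (setIidPr YA) ltn_add2r.
  apply: (glue_decomposable (fm_ends fmy) XA); first exact: half.
  apply: half => //; first exact: subsetDl.
    have := fm_even fmy; rewrite -(cardsID X A) (setIidPr XA) oddD oddX.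
    by rewrite addTb negbK.
  by rewrite delta_setD //; apply: fm_ends fmy.
have [m] := ubnP #|[set e | x e != 0]|; elim: m x => // m IHm x /ltnSE leSm fmx.
have [/existsP[X /andP[ntX tX]]|] :=
  boolP [exists X, nontrivial_odd A X && tight_cut s t x X].
  exact: tight_case ntX tX.
move/existsPn => ntight.
have {}ntight X : nontrivial_odd A X -> ~~ tight_cut s t x X.
  by move=> ntX; have := ntight X; rewrite ntX.
have [//|[[X ntX tX]|[y [yx ystar] [e ye]]]] := fm_cases fmx.
  exact: tight_case ntX tX.
have push z : star_kernel A s t x z -> (exists e, z e != 0) ->
    exists2 d : R, 0 < d & decomposable A s t (fun e => x e + d * z e).
  move=> kz z0; have [d d0 [fmd [S_lt|[X ntX tX]]]] := fm_push fmx ntight kz z0.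
    by exists d => //; apply: IHm fmd; apply: leq_trans (proper_card S_lt) leSm.
  by exists d => //; apply: tight_case fmd ntX tX.
have [d1 d1_gt0 dec1] := push y (conj yx ystar) (ex_intro _ e ye).
have [||d2 d2_gt0 dec2] := push (fun e => - y e).
- split=> [f /yx->|v vA]; first by rewrite oppr0.
  by rewrite sumrN ystar // oppr0.
- by exists e; rewrite oppr_eq0.
have d12 : d1 + d2 != 0 by rewrite gt_eqF // addr_gt0.
(* With these weights the displacements [d1 * y] and [- d2 * y] cancel. *)
apply: (decomposable_convex (a := d2 / (d1 + d2)) (b := d1 / (d1 + d2)) _ _ _ _
          dec1 dec2).
- by rewrite divr_ge0 ?ltW // addr_gt0.
- by rewrite divr_ge0 ?ltW // addr_gt0.
- by field.
- by move=> f; field.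
Qed.

End Edmonds.

(** * Tight perfect matchings of r-graphs *)

Section RGraph.

Variables (G : multigraph) (r : nat).
Hypothesis rG : r_graph G r.
Implicit Types (U : {set vertex G}) (C M : {set edge G}).

Lemma exists_ends : exists st : edge G -> vertex G * vertex G,
  forall e, (st e).1 != (st e).2 /\ ends e = [set (st e).1; (st e).2].
Proof.
apply: (fin_all_exists (P := fun e (p : vertex G * vertex G) =>
  p.1 != p.2 /\ ends e = [set p.1; p.2])) => e.
have [a [b H]] := cards2P _ (introT eqP (card_ends e)).
by exists (a, b).
Qed.

Lemma cut1 v : cut [set v] = star v :> {set edge G}.
Proof.
apply/setP=> e; rewrite !inE; case: (boolP (v \in ends e)) => ve.
  by rewrite (setIidPr _) ?sub1set // cards1.
rewrite (_ : _ :&: _ = set0) ?cards0 //; apply/setP=> u; rewrite !inE.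
by apply: contraNF ve => /andP[ue /eqP <-].
Qed.

(** Parity: [#|U|] is the sum of [#|ends e :&: U|] over the matching, and an edge outside the cut
    contributes 0 or 2. *)
Lemma pm_odd_cut M U : perfect_matching M -> odd #|U| -> (0 < #|M :&: cut U|)%N.
Proof.
move=> /forallP pmM; apply: contraTT; rewrite -eqn0Ngt cards_eq0 => /eqP M0.
have -> : #|U| = (\sum_(e in M) #|ends e :&: U|)%N.
  rewrite -sum1_card.
  transitivity (\sum_(v in U) \sum_(e in M) (v \in ends e))%N.
    apply: eq_bigr => v _; rewrite -(eqP (pmM v)) -sum1_card big_mkcond [RHS]big_mkcond /=.
    by apply: eq_bigr => e _; rewrite !inE; do 2 case: (_ \in _).
  rewrite exchange_big /=; apply: eq_bigr => e _.
  rewrite -sum1_card big_mkcond [RHS]big_mkcond /=.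
  by apply: eq_bigr => v _; rewrite !inE; do 2 case: (_ \in _).
apply: (big_ind (fun n => ~~ odd n)) => [//|m n|e Me].
  by rewrite oddD => /negbTE -> /negbTE ->.
have : e \notin cut U.
  apply/negP => eU; have := in_set0 e.
  by rewrite -M0 in_setI Me eU.
have := subset_leq_card (subsetIl (ends e) U); rewrite card_ends inE.
by case: #|_| => [|[|[]]].
Qed.

(** Stars are odd cuts of size [r], so no minimum odd cut is larger. *)
Lemma min_odd_cut_side C : min_odd_cut C -> exists2 U, U \in r_cut_sides G r & C = cut U.
Proof.
have [reg _ geq_r] := rG.
case/andP => oC /forallP minC; case/existsP: (oC) => U /andP[oU /eqP CU].
exists U => //; rewrite inE oU -CU eqn_leq geq_r // andbT.
case: (set_0Vmem U) => [U0|[v vU]]; first by rewrite U0 cards0 in oU.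
rewrite -(reg v) -cut1; apply: (implyP (minC _)).
by apply/existsP; exists [set v]; rewrite cards1 /=.
Qed.

Variable R : realFieldType.
Implicit Types (x y w : edge G -> R).

(** By Edmonds' theorem [x] is an average of perfect matchings. Each meets a cut of size [r] at
    least once by parity, and on average exactly once, so all those of positive weight are tight.
    One of them weighs at least the average. *)
Lemma tight_pm_average x w :
  (forall e, 0 <= x e) ->
  (forall U, U \in r_cut_sides G r -> \sum_(e in cut U) x e = 1) ->
  (forall U, odd #|U| -> 1 <= \sum_(e in cut U) x e) ->
  exists2 M, M \in tight_perfect_matchings G &
    \sum_e w e * x e <= \sum_(e in M) w e.
Proof.
move=> x_ge0 x_tight x_odd.
have [reg _ _] := rG.
have [st stP] := exists_ends.
pose s e := (st e).1; pose t e := (st e).2.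
have cutE U : cut U = delta s t U.
  apply/setP=> e; have [st_neq stE] := stP e; rewrite !inE stE -/(s e) -/(t e).
  rewrite -/(s e) -/(t e) in st_neq.
  rewrite setIUl cardsU.
  rewrite (_ : _ :&: _ :&: _ = set0) ?cards0 ?subn0; last first.
    apply/setP=> v; rewrite !inE; case: eqP => //= ->.
    by rewrite (negbTE st_neq) andbF.
  have c1 a : #|[set a] :&: U| = (a \in U).
    case: (boolP (a \in U)) => aU; first by rewrite (setIidPl _) ?sub1set ?cards1.
    by rewrite disjoint_setI0 ?cards0 // disjoints1.
  by rewrite !c1; do 2 case: (_ \in _).
have fmx : fractional_matching setT s t x.
  split.
  - by move=> e; rewrite !inE.
  - exact: x_ge0.
  - by move=> e; have [/eqP] := stP e.
  - move=> v _; rewrite -cutE x_tight // inE cards1 /= cut1; exact/eqP/reg.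
  - by move=> X _ oX; rewrite -cutE x_odd.
have [I [l [M [l_ge0 l1 MP lM]]]] := pm_polytope fmx.
have pmM i : 0 < l i -> perfect_matching (M i).
  by move=> li; apply/forallP => v; rewrite -cut1 cutE MP.
have sumM (g : edge G -> R) : \sum_e g e * x e = \sum_i l i * \sum_(e in M i) g e.
  transitivity (\sum_e \sum_i g e * (l i * (e \in M i)%:R)).
    by apply: eq_bigr => e _; rewrite -mulr_sumr lM.
  rewrite exchange_big /=; apply: eq_bigr => i _.
  rewrite mulr_sumr [RHS]big_mkcond /=; apply: eq_bigr => e _.
  by case: (_ \in _); rewrite ?mulr1 ?mulr0 // mulrC.
have tightM i : 0 < l i -> M i \in tight_perfect_matchings G.
  move=> li; rewrite inE pmM //=; apply/forallP => C; apply/implyP.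
  case/min_odd_cut_side => U rU ->.
  have oU : odd #|U| by move: rU; rewrite inE => /andP[].
  have := sumM (fun e => (e \in cut U)%:R).
  rewrite (eq_bigr (fun e => if e \in cut U then x e else 0)); last first.
    by move=> e _; case: (_ \in _); rewrite ?mul1r ?mul0r.
  rewrite -big_mkcond x_tight // -{1}l1 => /eqP.
  rewrite eq_sym -subr_eq0 -sumrB => /eqP.
  have ge0 j : true -> 0 <= l j * \sum_(e in M j) (e \in cut U)%:R - l j.
    move=> _; have := l_ge0 j; rewrite le0r => /orP[/eqP ->|lj].
      by rewrite mul0r subrr.
    rewrite sum_in_set setIC subr_ge0; apply: ler_peMr; first exact: ltW.
    by rewrite ler1n; apply: pm_odd_cut => //; apply: pmM.
  move/(psumr_eq0P ge0)/(_ i isT)/subr0_eq; rewrite sum_in_set [_ :&: M i]setIC.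
  rewrite -[X in _ = X]mulr1 => /(mulfI (lt0r_neq0 li))/eqP.
  by rewrite pnatr_eq1.
set W := \sum_e w e * x e.
have [/existsP[i /andP[li Wi]]|] :=
  boolP [exists i, (0 < l i) && (W <= \sum_(e in M i) w e)].
  by exists (M i) => //; apply: tightM.
move/existsPn => noti; exfalso.
have ge0 i : true -> 0 <= l i * (W - \sum_(e in M i) w e).
  move=> _; have := l_ge0 i; rewrite le0r => /orP[/eqP ->|li]; first by rewrite mul0r.
  by rewrite mulr_ge0 ?ltW // subr_gt0 ltNge; have := noti i; rewrite li.
have sum0 : \sum_i l i * (W - \sum_(e in M i) w e) = 0.
  rewrite (eq_bigr (fun i => l i * W - l i * \sum_(e in M i) w e)) => [|i _].
    by rewrite sumrB -mulr_suml l1 mul1r -sumM subrr.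
  by rewrite mulrBr.
have /negP[] : \sum_i l i != 0 by rewrite l1 oner_neq0.
apply/eqP/big1 => i _; apply/eqP; have := l_ge0 i; rewrite le0r => /orP[//|li].
have := psumr_eq0P ge0 sum0 (i := i) isT => /eqP.
rewrite mulf_eq0 => /orP[//|]; rewrite subr_eq0 => /eqP Wi.
by have := noti i; rewrite li -Wi lexx.
Qed.

Lemma tight_pm_perturbed y w : (0 < r)%N ->
  (forall e, `|y e| <= 1) ->
  (forall U, U \in r_cut_sides G r -> \sum_(e in cut U) y e = 0) ->
  exists2 M, M \in tight_perfect_matchings G &
    \sum_e w e * (r%:R^-1 + (r * r.+1)%:R^-1 * y e) <= \sum_(e in M) w e.
Proof.
move=> r_gt0 y1 y0; have [_ _ geq_r] := rG.
have rR : 0 < r%:R :> R by rewrite ltr0n.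
have r1R : 0 < r.+1%:R :> R by rewrite ltr0n.
have r_neq0 : r%:R != 0 :> R by rewrite gt_eqF.
have r1_neq0 : r.+1%:R != 0 :> R by rewrite gt_eqF.
(* As [1/r - 1/(r(r+1)) = 1/(r+1)], an odd cut with at least [r+1] edges keeps total weight at least
   1. *)
have lb e : r.+1%:R^-1 <= r%:R^-1 + (r * r.+1)%:R^-1 * y e.
  have -> : r.+1%:R^-1 = r%:R^-1 + (r * r.+1)%:R^-1 * -1 :> R.
    by rewrite natrM -natr1 in r1_neq0 *; field; rewrite r_neq0 r1_neq0.
  rewrite lerD2l ler_wpM2l ?invr_ge0 ?ler0n //.
  by have := y1 e; rewrite ler_norml => /andP[].
have tight U : U \in r_cut_sides G r ->
    \sum_(e in cut U) (r%:R^-1 + (r * r.+1)%:R^-1 * y e) = 1.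
  move=> rU; rewrite big_split /= -mulr_sumr y0 // mulr0 addr0 sumr_const.
  move: rU; rewrite inE => /andP[_ /eqP ->].
  by rewrite -[LHS]mulr_natr mulVf.
apply: tight_pm_average => // [e|U oU].
  by apply: le_trans (lb e); rewrite invr_ge0 ltW.
have [rU|rU] := boolP (U \in r_cut_sides G r); first by rewrite tight.
apply: le_trans (_ : \sum_(e in cut U) r.+1%:R^-1 <= _); last first.
  by apply: ler_sum => e _; apply: lb.
rewrite sumr_const -[X in _ <= X]mulr_natr mulrC ler_pdivlMr // mul1r ler_nat.
rewrite ltn_neqAle geq_r ?andbT.
  by move: rU; rewrite inE oU /= eq_sym.
by apply/existsP; exists U; rewrite oU /=.
Qed.

End RGraph.

(** * Shattering *)

Section Shattering.

Variable T : finType.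
Implicit Types (F : {set {set T}}) (A B K : {set T}).

Definition shatters F K : bool :=
  [forall B : {set T}, (B \subset K) ==> [exists A in F, A :&: K == B]].

Lemma shattersP F K :
  reflect (forall B, B \subset K -> exists2 A, A \in F & A :&: K = B) (shatters F K).
Proof.
apply: (iffP forallP) => [H B BK|H B].
  by have /exists_inP[A FA /eqP AK] := implyP (H B) BK; exists A.
by apply/implyP => /H[A FA AK]; apply/exists_inP; exists A => //; apply/eqP.
Qed.

(* Pajor's form of the Sauer-Shelah lemma. *)
Lemma card_shatters F : (#|F| <= #|[set K | shatters F K]|)%N.
Proof.
have [n] := ubnP #|F|; elim: n F => // n IHn F /ltnSE leFn.
have [F1|F2] := leqP #|F| 1.
  have [->|/set0Pn[A FA]] := eqVneq F set0; first by rewrite cards0.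
  apply: leq_trans F1 _; apply/card_gt0P; exists set0; rewrite inE.
  by apply/shattersP => B; rewrite subset0 => /eqP ->; exists A; rewrite ?setI0.
have /card_gt1P[A [B [FA FB AB]]] := F2.
have [x xAB] : exists x, (x \in A) != (x \in B).
  apply/existsP; apply: contraNT AB => /existsPn H; apply/eqP/setP => x.
  exact/eqP/negPn/H.
pose F' b := [set C in F | (x \in C) == b].
pose sh b := [set K | shatters (F' b) K].
have ltF b : (#|F' b| < #|F|)%N.
  apply: proper_card; rewrite properE; apply/andP; split.
    by apply/subsetP => C; rewrite inE => /andP[].
  apply/subsetPn; have [xA|xA] := boolP ((x \in A) == b).
    by exists B; rewrite // inE FB /= -(eqP xA) eq_sym.
  by exists A; rewrite // inE FA.
have IH b : (#|F' b| <= #|sh b|)%N by apply: IHn; apply: leq_trans (ltF b) leFn.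
(* All members of [F' b] agree at [x], so a trace on [K] that disagrees with them there is
   missed. *)
have x_sh b K : K \in sh b -> x \notin K.
  rewrite inE => /shattersP H; apply/negP => xK.
  have [C] := H (if b then K :\ x else K) ltac:(by case: b {H}; rewrite ?subD1set).
  rewrite inE => /andP[_ /eqP xC] /setP/(_ x); rewrite inE xK xC.
  by case: b {H xC}; rewrite ?inE ?eqxx ?xK.
have F'_sub b : F' b \subset F by apply/subsetP => C; rewrite inE => /andP[].
have cardF : #|F| = (#|F' true| + #|F' false|)%N.
  rewrite -cardsUI (_ : F' true :&: F' false = set0) ?cards0 ?addn0.
    by congr #|pred_of_set _|; apply/setP=> C; rewrite !inE; do 2 case: (_ \in _).
  by apply/setP=> C; rewrite !inE; do 2 case: (_ \in _).
rewrite cardF; apply: leq_trans (leq_add (IH true) (IH false)) _.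
rewrite -cardsUI.
(* A set [K] shattered by both halves is counted twice; [x |: K] makes up for it, being shattered by
   [F] but, as it contains [x], by neither half. *)
have inj : {in sh true :&: sh false &, injective (fun K => x |: K)}.
  move=> K L /setIP[/x_sh xK _] /setIP[/x_sh xL _] KL.
  by rewrite -(setU1K xK) KL setU1K.
rewrite -(card_in_imset inj).
set I := imset _ _.
have dis : (sh true :|: sh false) :&: I = set0.
  apply/setP=> K; rewrite in_setI in_set0; apply/negbTE/negP => /andP[shK /imsetP[L _ KL]].
  have : x \notin K by case/setUP: shK => /x_sh.
  by rewrite KL setU11.
rewrite -cardsUI dis cards0 addn0.
apply: subset_leq_card; apply/subsetP => K.
have mono b L : L \in sh b -> shatters F L.
  rewrite inE => /shattersP H; apply/shattersP => C /H[X FX XL].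
  by exists X => //; apply: subsetP FX.
case/setUP => [/setUP[]/mono|/imsetP[L /setIP[shT shF] ->]]; rewrite inE //.
apply/shattersP => C CL.
have CxL : C :\ x \subset L by rewrite subDset.
have shb b : L \in sh b by case: b.
have := shb (x \in C); rewrite inE => /shattersP/(_ _ CxL)[X].
rewrite inE => /andP[FX /eqP xX] XL; exists X => //.
apply/setP=> z; move/setP/(_ z): XL; rewrite !inE.
have [->|_] //= := eqVneq z x; by rewrite xX andbT.
Qed.

End Shattering.

Lemma leq_card_bigcup (I T : finType) (P : pred I) (F : I -> {set T}) :
  (#|\bigcup_(i | P i) F i| <= \sum_(i | P i) #|F i|)%N.
Proof.
apply: (big_ind2 (fun (A : {set T}) n => (#|A| <= n)%N)) => //.
  by rewrite cards0.
by move=> A m B n Am Bn; apply: leq_trans (leq_card_setU A B) (leq_add Am Bn).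
Qed.

(** Each [s] is encoded by the region below its graph. Traces of such regions on a column are
    nested, so a shattered set has at most one point per column and is the graph of a partial
    function, the threshold. There are at most [2 ^ #|E| * q.+1 ^ D] of these with domain of size at
    most [D]. *)
Lemma threshold_shatter (E : finType) (q D : nat) (S : {set {ffun E -> 'I_q.+1}}) :
  (2 ^ #|E| * q.+1 ^ D < #|S|)%N ->
  exists (J : {set E}) (th : E -> nat), (D < #|J|)%N /\
    forall P : {set E}, exists2 s, s \in S &
      forall j, j \in J -> (th j < s j)%N = (j \in P).
Proof.
move=> ltS.
pose enc (s : {ffun E -> 'I_q.+1}) := [set p : E * 'I_q.+1 | (p.2 < s p.1)%N].
have enc_inj : injective enc.
  have H s s' j : enc s = enc s' -> (s' j <= s j)%N.
    by move/setP/(_ (j, s j)); rewrite !inE /= ltnn => /esym/negbT; rewrite -leqNgt.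
  move=> s s' ss'; apply/ffunP=> j; apply/val_inj/eqP; rewrite eqn_leq.
  by rewrite (H s s') // (H s' s).
pose F := enc @: S.
have sh_fun K j a b : shatters F K -> (j, a) \in K -> (j, b) \in K -> a = b.
  move=> /shattersP shK.
  have lt c d : (j, c) \in K -> (j, d) \in K -> (c <= d)%N.
    move=> Kc Kd; rewrite leqNgt; apply/negP => dc.
    have [_ /imsetP[s _ ->] /setP H] := shK [set (j, c)] ltac:(by rewrite sub1set).
    have := H (j, c); have := H (j, d); rewrite !inE Kc Kd !andbT eqxx /=.
    rewrite xpair_eqE eqxx /= => sd sc; have : (d < s j)%N by apply: ltn_trans sc.
    by rewrite sd => /eqP dc'; rewrite dc' ltnn in dc.
  by move=> Ka Kb; apply/val_inj/eqP; rewrite eqn_leq !lt.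
have domP (K : {set E * 'I_q.+1}) j :
    reflect (exists a, (j, a) \in K) (j \in [set p.1 | p in K]).
  apply: (iffP imsetP) => [[[i a] Ka /= ->]|[a Ka]]; first by exists a.
  by exists (j, a).
have card_dom K : shatters F K -> #|[set p.1 | p in K]| = #|K|.
  move=> shK; apply: card_in_imset => -[j a] [i b] /= Ka Kb ji.
  by rewrite -ji in Kb *; rewrite (sh_fun _ _ _ _ shK Ka Kb).
pose th (K : {set E * 'I_q.+1}) j : 'I_q.+1 := odflt ord0 [pick a | (j, a) \in K].
have thP (K : {set E * 'I_q.+1}) j : j \in [set p.1 | p in K] -> (j, th K j) \in K.
  by case/domP => a Ka; rewrite /th; case: pickP => [//|/(_ a)]; rewrite Ka.
have [K shK DK] : exists2 K, shatters F K & (D < #|K|)%N.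
  apply/exists_inP; apply: contraLR ltS; rewrite -leqNgt => /exists_inPn small.
  have -> : #|S| = #|F| by rewrite card_imset.
  apply: leq_trans (card_shatters F) _.
  pose graph (J : {set E}) (f : {ffun E -> 'I_q.+1}) :=
    [set p : E * 'I_q.+1 | (p.1 \in J) && (f p.1 == p.2)].
  have sub : [set K | shatters F K] \subset
      \bigcup_(J : {set E} | (#|J| <= D)%N)
        (graph J @: [set f | f \in pffun_on ord0 (mem J) predT]).
    apply/subsetP => K; rewrite inE => shK; apply/bigcupP.
    exists [set p.1 | p in K]; first by rewrite card_dom // leqNgt small.
    (* Outside the domain [th] takes its default [ord0], so at most [q.+1 ^ #|J|] functions arise
       for a domain [J]. *)
    apply/imsetP; exists [ffun j => th K j].
      rewrite inE; apply/pffun_onP; split => //; apply/supportP => j nJ.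
      rewrite ffunE /th; case: pickP => //= a Ka.
      by case/domP: nJ; exists a.
    apply/setP => -[j a]; rewrite !inE /= ffunE.
    apply/idP/andP => [Ka|[Jj /eqP <-]]; last exact: thP.
    have Jj : j \in [set p.1 | p in K] by apply/domP; exists a.
    by split=> //; apply/eqP; apply: sh_fun shK _ Ka; apply: thP.
  apply: leq_trans (subset_leq_card sub) _.
  apply: leq_trans (leq_card_bigcup _ _) _.
  have -> : (2 ^ #|E| * q.+1 ^ D = \sum_(J : {set E}) q.+1 ^ D)%N.
    by rewrite -(cardsT E) -card_powerset powersetT cardsT sum_nat_const.
  rewrite [X in (_ <= X)%N](bigID (fun J : {set E} => #|J| <= D)%N) /=.
  apply: leq_trans (leq_addr _ _); apply: leq_sum => J JD.
  apply: leq_trans (leq_imset_card _ _) _.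
  rewrite cardsE card_pffun_on card_ord; exact: leq_pexp2l.
exists [set p.1 | p in K], (fun j => th K j); split; first by rewrite card_dom.
move=> P; have /shattersP/(_ [set p in K | p.1 \in P]) := shK.
case; first by apply/subsetP => p; rewrite inE => /andP[].
move=> _ /imsetP[s Ss ->] /setP H; exists s => // j /thP Kj.
by have := H (j, th K j); rewrite !inE /= Kj andbT.
Qed.

(** While only [k] coordinates are at 1 or -1, more than [n] coordinates of [J] are free. So the [n]
    equations leave a direction supported on these, along which one can move until another
    coordinate reaches 1 or -1. *)
Lemma exists_cube_face_point (R : realFieldType) (E : finType) (n k : nat)
    (b : 'I_n -> E -> R) (J : {set E}) : (n + k <= #|J|)%N ->
  exists y : E -> R, [/\ forall e, `|y e| <= 1, forall e, e \notin J -> y e = 0,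
    forall i, \sum_e y e * b i e = 0 & (k <= #|[set e | (`|y e| == 1)%R]|)%N].
Proof.
elim: k => [|k IHk] nk.
  exists (fun=> 0); split=> // [e|i]; first by rewrite normr0 ler01.
  by rewrite big1 // => e _; rewrite mul0r.
have [|y [y1 yJ yb ky]] := IHk; first by apply: leq_trans nk; rewrite addnS.
set A := [set e | (`|y e| == 1)%R] in ky.
have [kA|Ak] := ltnP k #|A|; first by exists y.
have ltK : (#|[set: 'I_n]| < #|J :\: A|)%N.
  rewrite cardsT card_ord; have := cardsID A J; have := subset_leq_card (subsetIr J A).
  by move: nk Ak; rewrite addnS; lia.
have [z [[e0 z0] zK zb]] := exists_kernel b ltK.
have zA e : e \in A -> z e = 0 by move=> eA; apply: zK; rewrite inE eA.
have ylt e : e \notin A -> `|y e| < 1 by rewrite inE lt_neqAle y1 andbT.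
pose sg (c : bool) : R := if c then 1 else -1.
have [c||d d0 [ge0 [[e1 s1] /= A1 eq0]]] := @exists_tight_shift R (E * bool)%type
  (fun c => c.1 \notin A) (fun c => 1 + sg c.2 * y c.1) (fun c => sg c.2 * z c.1).
- by move/ylt; rewrite ltr_norml /sg => /andP[]; case: c.2; lra.
- exists (e0, z e0 < 0) => /=.
    by apply: contraNN z0 => /zA ->.
  by rewrite /sg; move: z0; have [] := ltgtP (z e0) 0 => // z0 _; lra.
have y'A e : e \in A -> y e + d * z e = y e by move/zA ->; rewrite mulr0 addr0.
exists (fun e => y e + d * z e); split.
- move=> e; have [eA|eA] := boolP (e \in A); first by rewrite y'A.
  have := ge0 (e, true) eA; have := ge0 (e, false) eA; rewrite /= /sg ler_norml.
  by move=> ? ?; apply/andP; split; lra.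
- by move=> e eJ; rewrite yJ // zK ?mulr0 ?addr0 // inE negb_and eJ orbT.
- move=> i; rewrite (eq_bigr (fun e => y e * b i e + d * (z e * b i e))); last first.
    by move=> e _; rewrite mulrDl mulrA.
  rewrite big_split /= yb -mulr_sumr add0r.
  have := zb i (in_setT i); rewrite big_mkcond /=.
  rewrite (eq_bigr (fun e => z e * b i e)) => [->|e _]; first by rewrite mulr0.
  by case: ifPn => // /zK ->; rewrite mul0r.
- apply: leq_ltn_trans ky _; apply: proper_card; rewrite properE; apply/andP; split.
    by apply/subsetP => e eA; rewrite inE y'A //; move: eA; rewrite inE.
  apply/subsetPn; exists e1 => //; rewrite inE.
  case: s1 eq0 => /=; rewrite /sg => eq0.
    have -> : y e1 + d * z e1 = -1 by lra.
    by rewrite normrN1.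
  have -> : y e1 + d * z e1 = 1 by lra.
  by rewrite normr1.
Qed.

Lemma sum_pairing_vbasis (R : fieldType) (E : finType)
    (W : {vspace {ffun E -> R^o}}) (y : E -> R) (w : {ffun E -> R^o}) :
  (forall i : 'I_(\dim W), \sum_e y e * (vbasis W)`_i e = 0) ->
  w \in W -> \sum_e y e * w e = 0.
Proof.
move=> yb wW; rewrite [in LHS](coord_vbasis wW).
rewrite (eq_bigr (fun e => \sum_i coord (vbasis W) i w * (y e * (vbasis W)`_i e))).
  rewrite exchange_big big1 // => i _; rewrite -mulr_sumr yb mulr0 //.
move=> e _; rewrite sum_ffunE mulr_sumr; apply: eq_bigr => i _.
by rewrite ffunE mulrCA.
Qed.

(** * Weight vectors with small inner products *)

Section Sampling.

Variables (R : realFieldType) (E : finType) (q : nat).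
Implicit Types (s : {ffun E -> 'I_q.+1}) (y : E -> R).

Definition centered (k : 'I_q.+1) : R := k%:R - q%:R / 2.

Lemma card_flat_weights (W : {vspace {ffun E -> R^o}}) (D k : nat)
    (S : {set {ffun E -> 'I_q.+1}}) :
  (\dim W + k <= D.+1)%N ->
  (forall s, s \in S -> forall y, (forall e, `|y e| <= 1) ->
    (forall w, w \in W -> \sum_e y e * w e = 0) ->
    \sum_e centered (s e) * y e < k%:R / 2) ->
  (#|S| <= 2 ^ #|E| * q.+1 ^ D)%N.
Proof.
move=> Wk bad; rewrite leqNgt; apply/negP => /threshold_shatter[J [th [DJ shJ]]].
have [|y [y1 yJ yb yk]] := @exists_cube_face_point R E (\dim W) k
    (fun i e => (vbasis W)`_i e) J.
  exact: leq_trans Wk DJ.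
have yW w : w \in W -> \sum_e y e * w e = 0 by apply: sum_pairing_vbasis.
(* On [J], [s] exceeds the thresholds exactly where [y] is positive and [u] exactly where it is
   negative. By integrality they differ by at least 1 in the sign of [y] wherever [y] is nonzero. *)
have [s Ss sP] := shJ [set e | 0 < y e].
have [u Su uP] := shJ [set e | y e < 0].
have Hs := bad s Ss y y1 yW.
have Hu : - (\sum_e centered (u e) * y e) < k%:R / 2.
  have -> : - (\sum_e centered (u e) * y e) = \sum_e centered (u e) * - y e.
    by rewrite -sumrN; apply: eq_bigr => e _; rewrite mulrN.
  apply: bad => // [e|w wW]; first by rewrite normrN.
  rewrite (eq_bigr (fun e => - (y e * w e))) => [|e _]; last by rewrite mulNr.
  by rewrite sumrN yW // oppr0.
have : k%:R <= \sum_e (centered (s e) * y e - centered (u e) * y e).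
  apply: le_trans (_ : \sum_e `|y e| <= _).
    apply: le_trans (_ : #|[set e | (`|y e| == 1)%R]|%:R <= _); first by rewrite ler_nat.
    rewrite -sum1_card natr_sum big_mkcond /=; apply: ler_sum => e _.
    by rewrite inE; case: eqP => [->|_].
  apply: ler_sum => e _; rewrite -mulrBl.
  have [eJ|eJ] := boolP (e \in J); last by rewrite yJ // normr0 mulr0.
  have := sP e eJ; have := uP e eJ; rewrite !inE.
  have -> : centered (s e) - centered (u e) = (s e)%:R - (u e)%:R.
    by rewrite /centered; ring.
  have [y0|y0|->] := ltgtP (y e) 0; last by rewrite normr0 mulr0.
  - move=> thu /negbT; rewrite -leqNgt => sth.
    have : (s e).+1%:R <= (u e)%:R :> R by rewrite ler_nat (leq_ltn_trans sth).
    by rewrite -natr1 ltr0_norm // => ?; nra.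
  - move=> /negbT; rewrite -leqNgt => uth ths.
    have : (u e).+1%:R <= (s e)%:R :> R by rewrite ler_nat (leq_ltn_trans uth).
    by rewrite -natr1 gtr0_norm // => ?; nra.
by rewrite sumrB; lra.
Qed.

End Sampling.

(** * Random weights *)

(** From [1 - z <= expR (- z)] follows [expR z * (1 - z) <= 1], while [(1 + z + 2 * z ^+ 2) * (1 -
    z) = 1 + z ^+ 2 * (1 - 2 * z)] is at least 1. *)
Lemma expR_le_quadratic (R : realType) (z : R) :
  `|z| <= 1 / 2 -> expR z <= 1 + z + 2 * z ^+ 2.
Proof.
rewrite ler_norml => /andP[z1 z2].
have := expR_ge1Dx (- z); have := expR_gt0 z; have := expRxMexpNx_1 z.
set a := expR z; set b := expR (- z) => ab1 a0 b1.
have z3 : 0 < 1 - z by lra.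
have : a * (1 - z) <= (1 + z + 2 * z ^+ 2) * (1 - z).
  apply: (@le_trans _ _ 1); first by rewrite -[X in _ <= X]ab1 ler_pM2l.
  have -> : (1 + z + 2 * z ^+ 2) * (1 - z) = 1 + z ^+ 2 * (1 - 2 * z) by ring.
  by rewrite lerDl mulr_ge0 ?sqr_ge0 //; lra.
by rewrite ler_pM2r.
Qed.

Section Chernoff.

Variables (R : realType) (E : finType) (q : nat).
Local Notation cen := (centered R (q := q)).

Lemma centered_rev_ord (k : 'I_q.+1) : cen (rev_ord k) = - cen k.
Proof.
rewrite /centered /= subSS natrB; last by rewrite -ltnS.
by lra.
Qed.

Lemma sum_centered : \sum_k cen k = 0.
Proof.
have : \sum_k cen k = - \sum_k cen k.
  rewrite {1}(reindex_inj rev_ord_inj) /= -sumrN.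
  by apply: eq_bigr => k _; rewrite centered_rev_ord.
by lra.
Qed.

Lemma normr_centered k : `|cen k| <= q.+1%:R.
Proof.
have k0 : 0 <= k%:R :> R := ler0n _ _.
have kq : k%:R <= q%:R :> R by rewrite ler_nat -ltnS.
by rewrite /centered -[q.+1%:R]natr1 ler_norml; apply/andP; split; lra.
Qed.

(** Exponential Markov inequality: the sum of exponentials factors over the edges, and in each
    factor the linear term of the quadratic bound vanishes because the values are centred. *)
Lemma chernoff_centered (u : E -> R) (t h : R) :
  (forall e, `|u e| <= 1) -> 0 <= t -> t * q.+1%:R <= 1 / 2 ->
  #|[set s : {ffun E -> 'I_q.+1} | h <= \sum_e cen (s e) * u e]|%:R
    * expR (t * h - 2 * (t * q.+1%:R) ^+ 2 * #|E|%:R)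
  <= q.+1%:R ^+ #|E|.
Proof.
move=> u1 t0 tq; set A := finset _; set Q := q.+1%:R in tq *.
have Q0 : 0 <= Q :> R by rewrite /Q ler0n.
rewrite expRD mulrA expRN ler_pdivrMr ?expR_gt0 //.
apply: (@le_trans _ _ (\sum_(s : {ffun E -> 'I_q.+1}) expR (t * \sum_e cen (s e) * u e))).
  rewrite -sum1_card natr_sum mulr_suml big_mkcond /=; apply: ler_sum => s _.
  rewrite inE; case: ifP => [hs|_]; last exact: expR_ge0.
  by rewrite mul1r ler_expR ler_wpM2l.
rewrite (eq_bigr (fun s : {ffun E -> 'I_q.+1} => \prod_e expR (t * (cen (s e) * u e))));
  last by move=> s _; rewrite mulr_sumr expR_sum.
rewrite -(bigA_distr_bigA (fun e k => expR (t * (cen k * u e)))) /=.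
rewrite expRM_natr -exprMn -[X in _ <= X]prodr_const.
apply: ler_prod => e _; apply/andP; split.
  by apply: sumr_ge0 => k _; apply: expR_ge0.
set d := 2 * (t * Q) ^+ 2.
have tc k : `|t * (cen k * u e)| <= t * Q.
  rewrite normrM ger0_norm // ler_wpM2l // normrM -[Q]mulr1.
  by rewrite ler_pM ?normr_ge0 // normr_centered.
apply: (@le_trans _ _ (\sum_k (1 + d + t * (cen k * u e)))).
  apply: ler_sum => k _; apply: le_trans (expR_le_quadratic _) _.
    exact: le_trans (tc k) tq.
  have : (t * (cen k * u e)) ^+ 2 <= (t * Q) ^+ 2.
    by rewrite -real_normK ?num_real // lerXn2r ?nnegrE // (le_trans _ (tc k)).
  by rewrite /d; lra.
rewrite big_split /= -mulr_sumr -mulr_suml sum_centered mul0r mulr0 addr0.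
rewrite sumr_const card_ord -mulr_natl ler_wpM2l //.
exact: expR_ge1Dx.
Qed.

End Chernoff.

(** * Counting tight perfect matchings *)

Section Counting.

Variables (R : realType) (G : multigraph) (r a : nat).
Hypotheses (r_gt0 : (0 < r)%N) (a_gt0 : (0 < a)%N) (rG : r_graph G r).
Hypothesis low_rank : (8 * #|edge G| <= a * (#|edge G| - odd_cut_rank G R r))%N.
Hypothesis E_gt0 : (0 < #|edge G|)%N.

Local Notation m := #|edge G|.
Local Notation q := (2 ^ a).-1.
Local Notation sample := {ffun edge G -> 'I_q.+1}.

Let qE : q.+1 = (2 ^ a)%N.
Proof. by rewrite prednK // expn_gt0. Qed.

(** Gain per edge: the perturbation size [1/(r(r+1))] times an inner product of [m / a]. *)
Definition match_rate : R := ((r * r.+1) * a)%:R^-1.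

Definition favours (M : {set edge G}) (s : sample) : bool :=
  m%:R * match_rate <= \sum_e centered R (s e) * ((e \in M)%:R - r%:R^-1).

Definition unfavourable : {set sample} :=
  [set s | [forall M in tight_perfect_matchings G, ~~ favours M s]].

(** An unfavourable sample has small inner product with every admissible [y], since otherwise the
    perturbed point would yield a tight matching that it favours. Such samples are few by
    [card_flat_weights]. *)
Lemma card_unfavourable : (8 * #|unfavourable| <= q.+1 ^ m)%N.
Proof.
pose W := span [seq indicator R (cut U) | U in r_cut_sides G r].
have dimW : \dim W = odd_cut_rank G R r by [].
pose d := (m - odd_cut_rank G R r)%N.
(* The corank [d] is split in two: half makes the inner product [k / 2] linear in [m], half keeps
   [D] well below [m]. *)
pose k := d./2.+1; pose D := (odd_cut_rank G R r + d./2)%N.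
have d_gt0 : (0 < d)%N.
  by rewrite lt0n; apply/eqP => d0; move: low_rank E_gt0; rewrite -/d d0; lia.
have d2 : (d./2.*2 <= d)%N by rewrite -[X in (_ <= X)%N](odd_double_half d) leq_addl.
have d2' : (d <= d./2.*2.+1)%N.
  by rewrite -[X in (X <= _)%N](odd_double_half d) -addn1 addnC leq_add2l; case: odd.
have bound : (#|unfavourable| <= 2 ^ m * q.+1 ^ D)%N.
  apply: (@card_flat_weights R _ _ W D k).
    by rewrite dimW /D /k addnS.
  move=> s; rewrite inE => /forall_inP unfav y y1 yW; rewrite ltNge; apply/negP => ky.
  have [|M TM] := @tight_pm_perturbed G r rG R y (fun e => centered R (s e)) r_gt0 y1.
    move=> U rU; rewrite -[RHS](yW (indicator R (cut U))); last first.
      by apply: memv_span; apply: map_f; rewrite mem_enum.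
    rewrite big_mkcond /=; apply: eq_bigr => e _.
    by rewrite ffunE; case: (_ \in _); rewrite ?mulr1 ?mulr0.
  move=> le_w; have /negP := unfav M TM; apply; rewrite /favours.
  have -> : \sum_e centered R (s e) * ((e \in M)%:R - r%:R^-1) =
      \sum_(e in M) centered R (s e) -
      (\sum_e centered R (s e) * (r%:R^-1 + (r * r.+1)%:R^-1 * y e)) +
      (r * r.+1)%:R^-1 * \sum_e centered R (s e) * y e.
    rewrite [X in X - _]big_mkcond mulr_sumr -sumrB -big_split /=.
    apply: eq_bigr => e _; case: (e \in M) => /=; [rewrite mulr1n|rewrite mulr0n]; ring.
  apply: ler_wpDl; first by rewrite subr_ge0.
  rewrite /match_rate natrM invfM mulrCA ler_wpM2l ?invr_ge0 ?ler0n //.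
  apply: le_trans ky; rewrite ler_pdivrMr ?ltr0n // mulrAC ler_pdivlMr ?ltr0n //.
  by rewrite -!natrM ler_nat; move: low_rank; rewrite -/d /k; nia.
(* Thus [q.+1 ^ (m - D)] is at least [2 ^ (4 * m)]: one factor [2 ^ m] absorbs that of the
   shattering bound, and the other three give the factor 8. *)
have expD : (4 * m <= a * (m - D))%N.
  by move: low_rank; rewrite -/d /D; rewrite /d in d2 d2' d_gt0 *; nia.
apply: leq_trans (_ : 2 ^ (3 * m) * (2 ^ m * q.+1 ^ D) <= _)%N.
  by apply: leq_mul bound; rewrite (@leq_pexp2l 2 3) //; lia.
rewrite mulnA -expnD.
have Dm : (D <= m)%N by rewrite /D; rewrite /d in d2 d_gt0 *; lia.
have -> : (q.+1 ^ m = q.+1 ^ (m - D) * q.+1 ^ D)%N by rewrite -expnD subnK.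
rewrite leq_mul2r; apply/orP; right.
by rewrite qE -expnM leq_exp2l //; lia.
Qed.

Let card_sample : #|{: sample}| = (q.+1 ^ m)%N.
Proof. by rewrite card_ffun card_ord. Qed.

(** Reversing a sample negates its centred weights. Some sample and its reversal are both
    favourable, and one matching cannot beat the average for both. This later absorbs the factor 2
    of [expR_le_tight_pm]. *)
Lemma exists_two_tight_pm : (1 < #|tight_perfect_matchings G|)%N.
Proof.
pose rev (s : sample) : sample := [ffun e => rev_ord (s e)].
have revK : involutive rev by move=> s; apply/ffunP=> e; rewrite !ffunE rev_ordK.
have [s sU rsU] : exists2 s, s \notin unfavourable & rev s \notin unfavourable.
  have /subsetPn[s _] : ~~ ([set: sample] \subset unfavourable :|: rev @^-1: unfavourable).
    apply: contraL (card_unfavourable) => /subset_leq_card.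
    rewrite cardsT card_sample -ltnNge => /leq_trans/(_ (leq_card_setU _ _)).
    have -> : #|rev @^-1: unfavourable| = #|unfavourable|.
      rewrite -[LHS](card_imset _ (inv_inj revK)); apply: eq_card => s.
      apply/imsetP/idP => [[u + ->]|sU]; first by rewrite inE.
      by exists (rev s); [rewrite inE revK | rewrite revK].
    have : (0 < q.+1 ^ m)%N by rewrite expn_gt0.
    by lia.
  by rewrite !inE negb_or => /andP[? ?]; exists s; rewrite // inE.
move: sU rsU; rewrite !inE => /forall_inPn[M TM /negPn Ms] /forall_inPn[N TN /negPn Ns].
apply/card_gt1P; exists M, N; split=> //; apply/eqP => MN; move: Ms Ns.
have revN : \sum_e centered R (rev s e) * ((e \in N)%:R - r%:R^-1) =
    - \sum_e centered R (s e) * ((e \in N)%:R - r%:R^-1).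
  by rewrite -sumrN; apply: eq_bigr => e _; rewrite ffunE centered_rev_ord mulNr.
have : 0 < m%:R * match_rate by rewrite mulr_gt0 ?invr_gt0 ?ltr0n // !muln_gt0 r_gt0 a_gt0.
by rewrite MN /favours revN; lra.
Qed.

(** At least 7/8 of the samples favour a tight matching, while each matching is favoured by an
    exponentially small proportion of them. *)
Lemma expR_le_tight_pm :
  expR (match_rate ^+ 2 / (8 * q.+1%:R ^+ 2) * m%:R)
    <= 2 * #|tight_perfect_matchings G|%:R.
Proof.
set h := match_rate; set Q : R := q.+1%:R.
have Q1 : 1 <= Q by rewrite ler1n.
have h0 : 0 <= h by rewrite invr_ge0 ler0n.
have h1 : h <= 1.
  by rewrite invf_le1 ?ler1n ?ltr0n !muln_gt0 r_gt0 a_gt0.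
have r1 : (r%:R^-1 : R) <= 1 by rewrite invf_le1 ?ler1n ?ltr0n.
have r0 : 0 <= (r%:R^-1 : R) by rewrite invr_ge0 ler0n.
have Q_neq0 : Q != 0 by rewrite gt_eqF //; lra.
set c := h ^+ 2 / (8 * Q ^+ 2).
have favM M : #|[set s | favours M s]|%:R * expR (c * m%:R) <= Q ^+ m.
  (* This value of [t] maximises the exponent [t * h - 2 * (t * Q) ^+ 2] per edge. *)
  have := @chernoff_centered R (edge G) q (fun e => (e \in M)%:R - r%:R^-1)
    (h / (4 * Q ^+ 2)) (m%:R * h) _ _ _.
  have -> : h / (4 * Q ^+ 2) * (m%:R * h) - 2 * (h / (4 * Q ^+ 2) * Q) ^+ 2 * m%:R =
     c * m%:R by rewrite /c; field.
  apply.
  - move=> e; rewrite ler_norml; case: (e \in M); rewrite ?mulr1n ?mulr0n.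
      by apply/andP; split; lra.
    by apply/andP; split; lra.
  - by rewrite divr_ge0 // mulr_ge0 // exprn_ge0 //; lra.
  - have -> : h / (4 * Q ^+ 2) * Q = h / (4 * Q) by field.
    rewrite ler_pdivrMr; last by lra.
    by lra.
set T := tight_perfect_matchings G.
have cover : (q.+1 ^ m <= #|unfavourable| + \sum_(M in T) #|[set s | favours M s]|)%N.
  have sub : [set: sample] \subset
      unfavourable :|: \bigcup_(M in T) [set s | favours M s].
    apply/subsetP => s _; rewrite in_setU; have [//|] := boolP (s \in unfavourable).
    rewrite inE => /forall_inPn[M TM /negPn Ms] /=.
    by apply/bigcupP; exists M => //; rewrite inE.
  rewrite -card_sample -cardsT; apply: leq_trans (subset_leq_card sub) _.
  apply: leq_trans (leq_card_setU _ _) _.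
  by rewrite leq_add2l leq_card_bigcup.
have Qm : 0 < Q ^+ m by rewrite exprn_gt0 //; lra.
have bad : 8 * #|unfavourable|%:R <= Q ^+ m.
  by rewrite -natrX -natrM ler_nat card_unfavourable.
have {}cover : Q ^+ m <= #|unfavourable|%:R + \sum_(M in T) #|[set s | favours M s]|%:R.
  by rewrite -natrX -natr_sum -natrD ler_nat.
have : (\sum_(M in T) #|[set s | favours M s]|%:R) * expR (c * m%:R) <= #|T|%:R * Q ^+ m.
  rewrite mulr_suml [X in _ <= X]mulr_natl -[X in _ <= X]sumr_const.
  by apply: ler_sum => M _; apply: favM.
set F := \sum_(M in T) _ in cover *; set z := expR _ => Fz.
have z0 : 0 < z := expR_gt0 _.
rewrite -(ler_pM2r Qm).
have : Q ^+ m / 2 * z <= F * z by rewrite ler_pM2r //; lra.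
by lra.
Qed.

End Counting.

Theorem theorem6p3 (R : realType) (r : nat) (beta : R)
    (hr : (3 <= r)%N) (hbeta0 : 0 < beta) (hbeta1 : beta < 1) :
  exists2 theta : R, 0 < theta &
    forall G : multigraph, r_graph G r ->
      (odd_cut_rank G R r)%:R <= (1 - beta) * #|edge G|%:R ->
      expR (theta * #|edge G|%:R) <= #|tight_perfect_matchings G|%:R.
Proof.
have r_gt0 : (0 < r)%N by apply: leq_trans hr.
(* With [a * beta >= 8], a corank of at least [beta * m] gives [low_rank]. *)
pose a := (Num.truncn (8 / beta)).+1.
have a_beta : 8 <= a%:R * beta.
  by rewrite -ler_pdivrMr // ltW // truncnS_gt.
pose c : R := match_rate R r a ^+ 2 / (8 * (2 ^ a).-1.+1%:R ^+ 2).
have c_gt0 : 0 < c.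
  apply: divr_gt0; first by rewrite exprn_gt0 // invr_gt0 ltr0n !muln_gt0 r_gt0.
  by rewrite mulr_gt0 ?exprn_gt0 ?ltr0n.
(* For [z = expR (c / 2 * m)] and [N >= 2] one gets [z ^+ 2 <= 2 * N <= N ^+ 2], hence [z <= N]. *)
exists (c / 2) => [|G rG rk]; first by rewrite divr_gt0.
set N := #|tight_perfect_matchings G|.
have [E0|E_gt0] := posnP #|edge G|.
  (* Without edges one tight matching suffices; the unperturbed point provides it. *)
  have [||M TM _] := @tight_pm_perturbed G r rG R (fun=> 0) (fun=> 0) r_gt0.
  - by move=> e; rewrite normr0 ler01.
  - by move=> U _; rewrite big1.
  rewrite E0 mulr0 expR0 ler1n; apply/card_gt0P; by exists M.
have low_rank : (8 * #|edge G| <= a * (#|edge G| - odd_cut_rank G R r))%N.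
  have m_ge0 : 0 <= #|edge G|%:R :> R := ler0n _ _.
  have rk_le : (odd_cut_rank G R r <= #|edge G|)%N.
    by rewrite -(ler_nat R); nra.
  rewrite -(ler_nat R) !natrM natrB //.
  have a_ge0 : 0 <= a%:R :> R := ler0n _ _.
  by nra.
have N2 : 2 <= N%:R :> R by rewrite ler_nat; apply: exists_two_tight_pm low_rank E_gt0.
have := expR_le_tight_pm r_gt0 (ltn0Sn _ : (0 < a)%N) rG low_rank E_gt0; rewrite -/c -/N.
have -> : c * #|edge G|%:R = c / 2 * #|edge G|%:R + c / 2 * #|edge G|%:R by field.
rewrite expRD; set z := expR _ => zz; rewrite leNgt; apply/negP => Nz.
by nra.
Qed.
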